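(* Fix $n\ge 2$ and let $N=\binom{n+2}{2}-1$. For $s\geq 1$ let $\mathcal{H}(N,\mathcal{P}_n,s)$ be the random quadrics graph, and let $\mathcal{H}(N,\mathcal{P}_n,s)^c$ be its complement graph on the same set of vertices. Then for any $\varepsilon>0$, $$\lim_{s\to\infty}\mathbb{P}\left[\mathcal{H}(N,\mathcal{P}_n,s)^c\text{ contains a clique of size (at least) }\varepsilon s\right]=0.$$
   Context: Let $\mathrm{Sym}(n+1,\mathbb{R})$ be the space of real symmetric $(n+1)\times(n+1)$ matrices (identified with real quadratic forms in $n+1$ variables), endowed with the Frobenius inner product, and let $\mathbb{R}\mathrm{P}^N$ be its projectivization, with the quotient Riemannian metric of the unit sphere $S^N$ and the corresponding uniform (normalized volume) distribution. Let $\mathcal{P}_n=\{[Q]\in\mathbb{R}\mathrm{P}^N : Q \text{ positive definite}\}$. Let $q_1,\ldots,q_s$ be independent uniform samples in $\mathbb{R}\mathrm{P}^N$, and for $i\ne j$ let $\ell(q_i,q_j)=\{[\lambda_a q_i+\lambda_b q_j]\}_{[\lambda_a,\lambda_b]\in\mathbb{R}\mathrm{P}^1}$ be the projective line through them. The obstacle random graph $\mathcal{G}(N,\mathcal{P}_n,s)$ has vertices $q_1,\ldots,q_s$ and an edge between $q_i$ and $q_j$ ($i\neq j$) if and only if $\ell(q_i,q_j)\cap\mathcal{P}_n=\emptyset$. The random quadrics graph $\mathcal{H}(N,\mathcal{P}_n,s)$ is the induced subgraph of $\mathcal{G}(N,\mathcal{P}_n,s)$ obtained by discarding the vertices that fall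 inside $\mathcal{P}_n$. *)

(* Defs.v *)
From HB Require Import structures.
From mathcomp Require Import all_boot all_order all_algebra.
From mathcomp Require Import all_classical all_reals all_analysis.

Set Implicit Arguments.
Unset Strict Implicit.
Unset Printing Implicit Defensive.

Import Order.TTheory GRing.Theory Num.Theory.
Import numFieldNormedType.Exports.

Local Open Scope classical_set_scope.
Local Open Scope quotient_scope.
Local Open Scope ring_scope.

Record graph (V : Type) := Graph {
  vertices : set V ;
  adj : V -> V -> Prop
}.

Definition induced_subgraph (V : Type) (G : graph V) (A : set V) : graph V :=
  Graph (vertices G `&` A) (fun i j => [/\ A i, A j & adj G i j]).

Definition complement_graph (V : Type) (G : graph V) : graph V :=
  Graph (vertices G)
    (fun i j => [/\ vertices G i, vertices G j, i <> j & ~ adj G i j]).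

Definition is_clique (V : finType) (G : graph V) (S : {set V}) : Prop :=
  (forall i, i \in S -> vertices G i) /\
  (forall i j, i \in S -> j \in S -> i <> j -> adj G i j).

Section ProjectiveQuadrics.
Variables (R : realType) (n : nat).

(* Sym(n+1, R) minus the origin, with the subspace topology of 'M[R]_n.+1. *)
Definition nzsym : Type :=
  set_type [set A : 'M[R]_n.+1 | A^T = A /\ A != 0].
HB.instance Definition _ := Topological.on nzsym.

Definition nzsym_mx (Q : nzsym) : 'M[R]_n.+1 := set_val Q.

Definition proportional (Q Q' : nzsym) : bool :=
  `[< exists2 c : R, c != 0 & nzsym_mx Q' = c *: nzsym_mx Q >].

Lemma proportional_equiv : equiv_class_of proportional.
Proof.
split.
- by move=> Q; apply/asboolP; exists 1; rewrite ?oner_neq0 ?scale1r.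
- move=> Q Q'; apply: asbool_equiv_eq; split=> -[c c0 e]; exists c^-1;
    by rewrite ?invr_eq0// e scalerA mulVf// scale1r.
- move=> Q2 Q1 Q3 /asboolP[c c0 e] /asboolP[c' c'0 e']; apply/asboolP.
  by exists (c' * c); rewrite ?mulf_neq0// e' e scalerA.
Qed.

Canonical proportional_equivRel := EquivRelPack proportional_equiv.

(* RP^N: the projectivization of Sym(n+1, R), with the quotient topology. *)
Definition projQuad : Type :=
  quotient_topology {eq_quot proportional_equivRel}.
HB.instance Definition _ := Topological.on projQuad.
HB.instance Definition _ := Quotient.on projQuad.

Lemma nzsym1 : [set A : 'M[R]_n.+1 | A^T = A /\ A != 0] 1%:M.
Proof. by split; [exact: trmx1|exact: oner_neq0]. Qed.

Definition proj_class (Q : nzsym) : projQuad := \pi_projQuad Q.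

HB.instance Definition _ :=
  isPointed.Build projQuad (proj_class (exist _ 1%:M (mem_set nzsym1))).

(* RP^N with its Borel sigma-algebra. *)
Definition borelQuad := g_sigma_algebraType (@open projQuad).
HB.instance Definition _ := Measurable.on borelQuad.

(* The matrices of the quadrics of a class: the punctured line it stands for. *)
Definition rep (p : projQuad) : set 'M[R]_n.+1 :=
  [set A | exists2 Q : nzsym, proj_class Q = p & A = nzsym_mx Q].

(* Since 0 represents no class, (a, b) <> (0, 0) is automatic. *)
Definition proj_line (p p' : projQuad) : set projQuad :=
  [set r | exists A B : 'M[R]_n.+1, [/\ rep p A, rep p' B &
     exists a b : R, rep r (a *: A + b *: B)]].

Definition posdef (A : 'M[R]_n.+1) : Prop :=
  forall x : 'cV[R]_n.+1, x != 0 -> 0 < (x^T *m A *m x) ord0 ord0.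

Definition posdef_quadrics : set projQuad :=
  [set p | exists2 A, rep p A & posdef A].

End ProjectiveQuadrics.

Section UniformDistribution.
Variable R : realType.

(* Lebesgue measure on R^d, as the d-fold product of lebesgue_measure
   (cf. product_measure1), i.e. by iterated integration of sections. *)
Fixpoint lebesgue_tuple (d : nat) : set (d.-tuple R) -> \bar R :=
  match d with
  | 0 => fun A => \d_([tuple] : 0.-tuple R) A
  | d'.+1 => fun A =>
      (\int[lebesgue_measure]_(x in [set: measurableTypeR R])
         lebesgue_tuple [set t : d'.-tuple R | A (cons_tuple x t)])%E
  end.

Definition quadN (n : nat) : nat := 'C(n.+2, 2) - 1.

(* Sym(n+1, R) parametrized by the N+1 entries on or above the diagonal:
   column after column, entry (i, j), i <= j, has rank j(j+1)/2 + i. *)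
Definition sym_of_tuple (n : nat) (t : (quadN n).+1.-tuple R) : 'M[R]_n.+1 :=
  \matrix_(i, j) nth 0 t ('C((maxn i j).+1, 2) + minn i j).

Definition frobenius (n : nat) (A B : 'M[R]_n.+1) : R := \tr (A^T *m B).

(* For B = setT this is the volume of the Frobenius unit ball (minus 0).  The coordinates
   of sym_of_tuple are orthogonal but not orthonormal (the Frobenius square norm
   of E_ij + E_ji is 2); this multiplies volumes by a constant. *)
Definition cone_volume (n : nat) (B : set (projQuad R n)) : \bar R :=
  lebesgue_tuple [set t | frobenius (sym_of_tuple t) (sym_of_tuple t) <= 1 /\
                          exists2 p, B p & rep p (sym_of_tuple t)].

(* The volume of a subset of the unit sphere S^N is N+1 times the Lebesgue
   volume of the cone over it, and S^N -> RP^N is a two-sheeted local isometry;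
   the constants cancel in the normalized volume of RP^N. *)
Definition uniform_quad (n : nat) (B : set (projQuad R n)) : \bar R :=
  (fine (cone_volume B) / fine (cone_volume [set: projQuad R n]))%:E.

End UniformDistribution.

Section RandomGraph.
Variables (R : realType) (n : nat).

Definition mutually_independent d (T : measurableType d) d'
    (T' : measurableType d') (P : probability T R) (I : finType)
    (X : I -> {RV P >-> T'}) : Prop :=
  forall (J : {set I}) (B : I -> set T'),
    (forall i, i \in J -> measurable (B i)) ->
    P (\bigcap_(i in [set` J]) (X i @^-1` B i)) =
    (\prod_(i in J) P (X i @^-1` B i))%E.

Definition iid_uniform d (T : measurableType d) (P : probability T R)
    (I : finType) (q : I -> {RV P >-> borelQuad R n}) : Prop :=
  mutually_independent q /\
  forall i (B : set (borelQuad R n)), measurable B ->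
    distribution P (q i) B = uniform_quad B.

(* Vertices are the indices of the sample points. *)
Definition obstacle_graph (s : nat) (O : set (projQuad R n))
    (p : 'I_s -> projQuad R n) : graph 'I_s :=
  Graph setT (fun i j => i <> j /\ proj_line (p i) (p j) `&` O = set0).

Definition quadrics_graph (s : nat) (p : 'I_s -> projQuad R n) : graph 'I_s :=
  induced_subgraph (obstacle_graph (@posdef_quadrics R n) p)
    [set i | ~ posdef_quadrics (p i)].

End RandomGraph.

(* Main.v *)
Require Import Defs.
From HB Require Import structures.
From mathcomp Require Import all_boot all_order all_algebra.
From mathcomp Require Import all_classical all_reals all_analysis.
From mathcomp Require Import measurable_realfun ring lra zify.
Import Order.TTheory GRing.Theory Num.Theory.
Import numFieldNormedType.Exports.
Local Open Scope classical_set_scope.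
Local Open Scope ring_scope.

(* If [a A + b B] is positive definite then, after a change of signs, [A] and [B]
   are nowhere both nonpositive, so one of the four sign pairs (+,+), (+,-),
   (-,+), (-,-) is never taken by [(A, B)]: the quadrics [A] and [B] do not
   cross.  Record the signs of a form on the first [M] rational vectors.  A clique
   of the complement graph lies in a union [U] of sign cells no two of which cross
   on these vectors, and for fixed [M] there are finitely many such [U].

   The measure of such a [U] is at most any given [e] when [M] is large.
   Indeed, if [A u > 0 > A w], let [D] be the form vanishing at [u] and at [w]
   with [D (u + s w) = c s], [c > 0]: looking at the roots of [A] and [A + h D] on
   the line [u + s w], one sees that [A] and [A + h D] cross for every [h > 0].
   Hence translates of [U] along [D] are disjoint up to a small error, which is
   impossible for many translates inside a bounded set unless [U] is small.  The
   semidefinite forms are treated in the same way with [D] plus or minus the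
   identity, as then [A + h D] is definite.

   Finally, a clique of size [eps s] puts [eps s] independent points in one of the
   finitely many [U], each of measure at most [4^-k] with [k eps >= 1]; summing
   over the [2^s] index sets bounds the probability by a constant times [2^-s]. *)

Set Implicit Arguments.
Unset Strict Implicit.

(** * Quadratic forms *)

Lemma continuous_sum (R : realType) (T : topologicalType) (I : Type)
    (r : seq I) (F : I -> T -> R) :
  (forall i, continuous (F i)) -> continuous (fun x => \sum_(i <- r) F i x).
Proof.
move=> cF; elim: r => [|i r IH].
  rewrite (_ : (fun x => _) = cst 0); first by move=> x; exact: cvg_cst.
  by apply/funext => x; rewrite big_nil.
rewrite (_ : (fun x => _) = F i \+ (fun x => \sum_(i <- r) F i x)).
  by move=> x; apply: cvgD; [exact: cF|exact: IH].
by apply/funext => x; rewrite big_cons.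
Qed.

Section quadratic_forms.
Variables (R : realType) (m : nat).
Implicit Types (A B : 'M[R]_m) (u v w : 'cV[R]_m).

Definition bform A u v : R := (u^T *m A *m v) ord0 ord0.
Definition qform A v : R := bform A v v.
Definition ratvec (v : 'cV[rat]_m) : 'cV[R]_m := map_mx ratr v.

Lemma bformE A u v : bform A u v = \sum_i \sum_j u i ord0 * A i j * v j ord0.
Proof.
rewrite /bform mxE exchange_big; apply: eq_bigr => j _ /=.
by rewrite mxE big_distrl; apply: eq_bigr => i _; rewrite mxE.
Qed.

Lemma qformD A B v : qform (A + B) v = qform A v + qform B v.
Proof. by rewrite /qform /bform mulmxDr mulmxDl mxE. Qed.

Lemma qformZ a A v : qform (a *: A) v = a * qform A v.
Proof. by rewrite /qform /bform -scalemxAr -scalemxAl mxE. Qed.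

Lemma qformN A v : qform (- A) v = - qform A v.
Proof. by rewrite -scaleN1r qformZ mulN1r. Qed.

Lemma qform0 v : qform 0 v = 0.
Proof. by rewrite -(scale0r 1%:M) qformZ mul0r. Qed.

Lemma bformC A u v : A^T = A -> bform A u v = bform A v u.
Proof.
move=> As; rewrite !bformE exchange_big; apply: eq_bigr => i _.
by apply: eq_bigr => j _; rewrite -{1}As mxE; ring.
Qed.

Lemma qform_line A u w s : A^T = A ->
  qform A (u + s *: w) = qform A u + 2 * bform A u w * s + qform A w * s ^+ 2.
Proof.
move=> As; transitivity (qform A u + s * bform A u w +
    (s * bform A w u + s * (s * qform A w))).
  have -> : qform A (u + s *: w) =
      ((u^T + s *: w^T) *m A *m (u + s *: w)) ord0 ord0.
    by congr ((_ *m _ *m _) _ _); apply/matrixP => i j; rewrite !mxE.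
  rewrite !mulmxDl !mulmxDr -!scalemxAl -!scalemxAr.
  have addE (X Y : 'M[R]_1) : (X + Y) ord0 ord0 = X ord0 ord0 + Y ord0 ord0.
    by rewrite mxE.
  have scaleE a (X : 'M[R]_1) : (a *: X) ord0 ord0 = a * X ord0 ord0.
    by rewrite mxE.
  by rewrite !addE !scaleE /qform /bform; ring.
by rewrite (@bformC A w u)//; ring.
Qed.

Lemma qform_scale A a v : qform A (a *: v) = a ^+ 2 * qform A v.
Proof.
rewrite /qform !bformE big_distrr; apply: eq_bigr => i _ /=.
by rewrite big_distrr; apply: eq_bigr => j _ /=; rewrite !mxE; ring.
Qed.

Lemma qformx0 A : qform A 0 = 0.
Proof. by rewrite -(scale0r (0 : 'cV[R]_m)) qform_scale expr0n mul0r. Qed.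

Lemma qform1E v : qform 1%:M v = \sum_i (v i ord0) ^+ 2.
Proof.
rewrite /qform bformE; apply: eq_bigr => i _.
rewrite (bigD1 i)//= big1 ?addr0 => [|j ji]; rewrite !mxE ?eqxx.
  by rewrite mulr1n mulr1 expr2.
by rewrite eq_sym (negbTE ji) mulr0n mulr0 mul0r.
Qed.

Lemma qform1_ge0 v : 0 <= qform 1%:M v.
Proof. by rewrite qform1E sumr_ge0// => i _; exact: sqr_ge0. Qed.

Lemma qform1_eq0 v : qform 1%:M v = 0 -> v = 0.
Proof.
rewrite qform1E => /eqP; rewrite psumr_eq0 => [/allP v0|i _]; last exact: sqr_ge0.
apply/colP => i; rewrite !mxE; apply/eqP; rewrite -sqrf_eq0.
by apply: v0; rewrite mem_index_enum.
Qed.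

Lemma qform1_gt0 v : v != 0 -> 0 < qform 1%:M v.
Proof.
move=> v0; rewrite lt_neqAle qform1_ge0 andbT eq_sym.
by apply: contra v0 => /eqP/qform1_eq0 ->.
Qed.

Lemma qform_continuous A : continuous (fun v : 'cV[R]_m => qform A v).
Proof.
rewrite (_ : (fun v => _) = fun v =>
   \sum_i \sum_j v i ord0 * A i j * v j ord0); last first.
  by apply/funext => x; rewrite /qform bformE.
apply: continuous_sum => i; apply: continuous_sum => j.
have c k : continuous (fun v : 'cV[R]_m => v k ord0) by exact: coord_continuous.
by move=> v; exact: (cvgM (cvgMr_tmp (c i v)) (c j v)).
Qed.

Lemma ratvec_dense (U : set 'cV[R]_m) : open U -> U !=set0 ->
  exists q : 'cV[rat]_m, U (ratvec q).
Proof.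
move=> oU [x Ux]; have /nbhs_ballP[e /= e0 xeU] := open_nbhs_nbhs (conj oU Ux).
have /choice[f fP] (i : 'I_m) : exists q : rat, `|x i ord0 - ratr q| < e.
  have [|q] := @rat_in_itvoo R (x i ord0) (x i ord0 + e); first by rewrite ltrDl.
  rewrite in_itv/= => /andP[q1 q2]; exists q.
  by rewrite ltr_norml; apply/andP; split; lra.
exists (\col_i f i); apply: xeU; split=> // i j.
by rewrite !mxE ord1; exact: fP.
Qed.

Lemma qform_rat_ge0 A : (forall q : 'cV[rat]_m, 0 <= qform A (ratvec q)) ->
  forall v, 0 <= qform A v.
Proof.
move=> A0 v; rewrite leNgt; apply/negP => vlt0.
have [||w] := @ratvec_dense [set x | qform A x < 0].
- by have /continuousP/(_ _ (@open_lt R 0)) := @qform_continuous A.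
- by exists v.
by rewrite /= ltNge A0.
Qed.

End quadratic_forms.
Arguments ratvec R {m} v.
Arguments qform {R m} A v.

(** * Positive definiteness: openness and tests on rational vectors *)

Section definite_forms.
Variables (R : realType) (n : nat).
Implicit Types (A B : 'M[R]_n.+1).

(** Homogeneity reduces this to the unit sphere, where [A] attains a positive minimum by
    compactness; [k] is an integer above its inverse. An integer constant lets positive definiteness
    be written as a countable union over [k]. *)
Lemma posdef_bounded_below A : posdef A ->
  exists2 k : nat, (0 < k)%N & forall v, qform 1%:M v <= k%:R * qform A v.
Proof.
(* The sphere is made of row vectors because [EVT_min_rV] is about these. *)
move=> pA; pose S : set 'rV[R]_n.+1 := [set x | qform 1%:M x^T = 1].
have ctr : continuous (fun x : 'rV[R]_n.+1 => x^T).
  move=> x U [V xV VU]; exists (fun i j => V j i).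
    by move=> i j; have := xV j i; rewrite mxE.
  by move=> y yV; apply: VU => i j; rewrite mxE; exact: yV.
have cq B : continuous (fun x : 'rV[R]_n.+1 => qform B x^T).
  move=> x; apply: (@continuous_comp _ _ _ trmx (qform B)); first exact: ctr.
  exact: qform_continuous.
have S0 : S !=set0.
  exists (delta_mx ord0 ord0); rewrite /S /= qform1E (bigD1 ord0)//= big1.
    by rewrite !mxE eqxx expr1n addr0.
  by move=> i i0; rewrite !mxE (negbTE i0) andbF expr0n.
have cS : compact S.
  apply: bounded_closed_compact.
    exists 1; split => // x x1 y Sy; apply: le_trans (ltW x1).
    rewrite [leLHS]/Num.Def.normr/= mx_normrE bigmax_le// => -[i j] _ /=.
    rewrite ord1 -(@ler_pXn2r _ 2)// ?nnegrE// expr1n real_normK ?num_real//.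
    rewrite -Sy qform1E (bigD1 j)//= mxE lerDl sumr_ge0// => k _.
    exact: sqr_ge0.
  rewrite (_ : S = (fun x => qform 1%:M x^T) @^-1` [set 1])//.
  by apply: closed_comp; [move=> x _; exact: cq|exact: closed_eq].
have [c /set_mem cS1 cmin] := EVT_min_rV S0 cS (continuous_subspaceT (cq A)).
have mu0 : 0 < qform A c^T.
  apply: pA; apply/eqP => c0; move: cS1; rewrite /S /= c0 qformx0.
  by move=> /eqP; rewrite eq_sym oner_eq0.
set mu := qform A c^T in mu0.
exists (Num.bound mu^-1) => [|v].
  rewrite -(@ltr_nat R); apply: le_lt_trans (archi_boundP _).
    by rewrite invr_ge0 ltW.
  by rewrite invr_ge0 ltW.
have [->|v0] := eqVneq v 0.
  by rewrite !qformx0 mulr0.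
have q0 := qform1_gt0 v0; set r := Num.sqrt (qform 1%:M v).
have r2 : r ^+ 2 = qform 1%:M v by rewrite sqr_sqrtr// ltW.
have : mu <= qform A (r^-1 *: v).
  rewrite -[_ *: _]trmxK; apply: cmin; apply/mem_set; rewrite /S /= trmxK.
  by rewrite qform_scale exprVn r2 mulVf// gt_eqF.
rewrite qform_scale exprVn r2 mulrC ler_pdivlMr// -ler_pdivlMl// mulrC => h.
apply: le_trans h _; rewrite mulrC ler_wpM2r ?(ltW (pA _ v0))//.
by apply/ltW/archi_boundP; rewrite invr_ge0 ltW.
Qed.

(** The margin [qform 1%:M] survives the passage by density from rational vectors to all vectors,
    whereas bare positivity would only give a semidefinite form. *)
Lemma posdef_of_rat A (k : R) : 0 <= k ->
  (forall q : 'cV[rat]_n.+1, qform 1%:M (ratvec R q) <= k * qform A (ratvec R q)) ->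
  posdef A.
Proof.
move=> k0 h x x0; have : 0 <= qform (k *: A - 1%:M) x.
  by apply: qform_rat_ge0 => q; rewrite qformD qformN qformZ subr_ge0.
rewrite qformD qformN qformZ subr_ge0 => {}h.
by have := lt_le_trans (qform1_gt0 x0) h; rewrite pmulr_rgt0// lt_neqAle k0 andbT;
  apply/eqP => k00; move: (lt_le_trans (qform1_gt0 x0) h); rewrite -k00 mul0r ltxx.
Qed.

(** [A] is at least [qform 1%:M] divided by [k], and a perturbation with entries below [e] changes
    the form by at most [e (n+1)] times [qform 1%:M]; the chosen [e] makes this half the margin. *)
Lemma posdef_near A : posdef A -> exists2 e : R, 0 < e &
  forall B, (forall i j, `|A i j - B i j| < e) -> posdef B.
Proof.
move=> /posdef_bounded_below[k k0 Ak].
have kR : 0 < k%:R :> R by rewrite ltr0n.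
exists (2 * k%:R * n.+1%:R)^-1 => [|B AB x x0].
  by rewrite invr_gt0 !mulr_gt0// ltr0n.
set e := _^-1 in AB; have e0 : 0 < e by rewrite invr_gt0 !mulr_gt0// ltr0n.
have small : qform (A - B) x <= e * n.+1%:R * qform 1%:M x.
  (* This double sum dominates [qform (A - B) x] term by term, through
     [|x_i x_j| <= (x_i^2 + x_j^2) / 2]. *)
  have -> : e * n.+1%:R * qform 1%:M x =
      \sum_i \sum_j e * ((x i ord0 ^+ 2 + x j ord0 ^+ 2) / 2).
    under eq_bigr do rewrite -big_distrr/= -big_distrl/= big_split/=.
    rewrite -big_distrr/= -mulrA; congr (_ * _).
    rewrite -big_distrl/= big_split/= qform1E.
    rewrite exchange_big/= !sumr_const card_ord.
    by rewrite -mulr_natl; field.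
  rewrite /qform bformE; apply: ler_sum => i _; apply: ler_sum => j _.
  rewrite !mxE; apply: le_trans (ler_norm _) _; rewrite !normrM.
  rewrite mulrAC mulrC; apply: ler_pM => //; first exact/ltW/AB.
  have := sqr_ge0 (`|x i ord0| - `|x j ord0|).
  rewrite -(real_normK (num_real (x i ord0))) -(real_normK (num_real (x j ord0))).
  by nra.
have := Ak x; have q0 := qform1_gt0 x0.
have {small} : qform A x - qform B x <= (2 * k%:R)^-1 * qform 1%:M x.
  rewrite -qformN -qformD; apply: le_trans small _.
  rewrite ler_pM2r// /e invfM -mulrA mulVf ?mulr1// pnatr_eq0//.
set a := qform A x; set c := qform 1%:M x => h1 h2.
have h3 : c / k%:R <= a by rewrite ler_pdivrMr// mulrC.
rewrite -[ltRHS]/(qform B x).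
have : (2 * k%:R)^-1 * c = c / k%:R / 2 by field; rewrite gt_eqF.
have : 0 < c / k%:R by rewrite divr_gt0.
by lra.
Qed.

End definite_forms.

(** * Crossing forms *)

(** Since [a c < 0], the reduced discriminant exceeds [b^2]; its square root [d] satisfies
    [|b| < d], so the numerators [- b + d] and [- b - d] have opposite signs. *)
Lemma quadratic_roots (R : rcfType) (a b c : R) : 0 < a -> c < 0 ->
  exists s1 s2 : R, [/\ s1 < 0, 0 < s2 &
    forall s, a + 2 * b * s + c * s ^+ 2 = c * (s - s1) * (s - s2)].
Proof.
move=> a0 c0; set d := Num.sqrt (b ^+ 2 - a * c).
have bd : b ^+ 2 < b ^+ 2 - a * c by nra.
have d2 : d ^+ 2 = b ^+ 2 - a * c.
  by rewrite sqr_sqrtr// (le_trans _ (ltW bd))// sqr_ge0.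
have d0 : 0 <= d by exact: sqrtr_ge0.
have bltd : `|b| < d.
  by rewrite -(@ltr_pXn2r _ 2)// ?nnegrE// d2 real_normK ?num_real.
move: bltd; rewrite ltr_norml => /andP[b1 b2].
exists ((- b + d) / c), ((- b - d) / c); split.
- by rewrite pmulr_rlt0 ?invr_lt0//; lra.
- by rewrite nmulr_rgt0 ?invr_lt0//; lra.
- move=> s; have -> : a = (b ^+ 2 - d ^+ 2) / c.
    by rewrite d2; field; rewrite lt_eqF.
  by field; rewrite lt_eqF.
Qed.

Lemma ratr_line (R : realType) m (u w : 'cV[rat]_m) (s : rat) :
  ratvec R u + ratr s *: ratvec R w = ratvec R (u + s *: w).
Proof. by apply/colP => i; rewrite !mxE rmorphD rmorphM. Qed.

Section crossing.
Variables (R : realType) (m : nat).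
Implicit Types (A B D : 'M[R]_m) (v : 'cV[R]_m) (u w : 'cV[rat]_m).

(* Up to replacing [A] and [B] by their opposites, the four vectors realise the
   sign pairs (+,+), (+,-), (-,+) and (-,-); writing this with products makes it
   invariant under rescaling. *)
Definition crossing_at A B v1 v2 v3 v4 : bool :=
  [&& 0 < qform A v1 * qform A v2, qform A v1 * qform A v3 < 0,
      qform A v1 * qform A v4 < 0, qform B v1 * qform B v2 < 0,
      0 < qform B v1 * qform B v3 & qform B v1 * qform B v4 < 0].

(** A number that codes no vector gives 0, where every form vanishes, so it never realises a strict
    sign. *)
Definition ratvec_nth (i : nat) : 'cV[R]_m := ratvec R (odflt 0 (unpickle i)).

(** The bound [M] makes this depend on finitely many signs; a crossing at given rational vectors is
    seen once [M] is large. *)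
Definition crosses (M : nat) A B : bool :=
  [exists i1 : 'I_M, exists i2 : 'I_M, exists i3 : 'I_M, exists i4 : 'I_M,
    crossing_at A B (ratvec_nth i1) (ratvec_nth i2) (ratvec_nth i3)
                    (ratvec_nth i4)].

Lemma crossesP M A B : reflect (exists i1 i2 i3 i4 : 'I_M,
    crossing_at A B (ratvec_nth i1) (ratvec_nth i2) (ratvec_nth i3)
                    (ratvec_nth i4))
  (crosses M A B).
Proof.
apply: (iffP existsP) => -[i1]; first move=> /existsP[i2 /existsP[i3 /existsP[i4 h]]].
  by exists i1, i2, i3, i4.
by move=> [i2 [i3 [i4 h]]]; exists i1; apply/existsP; exists i2;
  apply/existsP; exists i3; apply/existsP; exists i4.
Qed.

Lemma ratvec_nth_pickle u : ratvec_nth (pickle u) = ratvec R u.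
Proof. by rewrite /ratvec_nth pickleK. Qed.

Lemma crosses_widen M M' A B : (M <= M')%N -> crosses M A B -> crosses M' A B.
Proof.
move=> MM' /crossesP[i1 [i2 [i3 [i4 h]]]]; apply/crossesP.
by exists (widen_ord MM' i1), (widen_ord MM' i2), (widen_ord MM' i3),
  (widen_ord MM' i4).
Qed.

Lemma crosses_of_quadrants A B u1 u2 u3 u4 :
  0 < qform A (ratvec R u1) -> 0 < qform B (ratvec R u1) ->
  0 < qform A (ratvec R u2) -> qform B (ratvec R u2) < 0 ->
  qform A (ratvec R u3) < 0 -> 0 < qform B (ratvec R u3) ->
  qform A (ratvec R u4) < 0 -> qform B (ratvec R u4) < 0 ->
  exists M, crosses M A B.
Proof.
move=> A1 B1 A2 B2 A3 B3 A4 B4.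
pose M := \max_(u <- [:: u1; u2; u3; u4]) (pickle u).+1.
have lM u : u \in [:: u1; u2; u3; u4] -> (pickle u < M)%N.
  by move=> uin; exact: (@leq_bigmax_seq _ _ xpredT (fun u => (pickle u).+1)).
exists M; apply/crossesP.
have h1 : (pickle u1 < M)%N by apply: lM; rewrite !inE eqxx.
have h2 : (pickle u2 < M)%N by apply: lM; rewrite !inE eqxx ?orbT.
have h3 : (pickle u3 < M)%N by apply: lM; rewrite !inE eqxx ?orbT.
have h4 : (pickle u4 < M)%N by apply: lM; rewrite !inE eqxx ?orbT.
exists (Ordinal h1), (Ordinal h2), (Ordinal h3), (Ordinal h4).
by rewrite /= !ratvec_nth_pickle; apply/and5P; split; [nra..|apply/andP; split; nra].
Qed.

(** At one of the four vectors of a crossing both [a A] and [b B] are nonpositive, whatever the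
    signs of [a] and [b]. *)
Lemma posdef_pencil_not_crosses M A B (a b : R) :
  (forall x : 'cV[R]_m, x != 0 -> 0 < qform (a *: A + b *: B) x) ->
  ~~ crosses M A B.
Proof.
move=> pd; apply/negP => /crossesP[i1 [i2 [i3 [i4]]]].
move: (ratvec_nth i1) (ratvec_nth i2) (ratvec_nth i3) (ratvec_nth i4).
move=> v1 v2 v3 v4 /and5P[A12 A13 A14 B12 /andP[B13 B14]].
have pos v : qform A v != 0 -> 0 < a * qform A v + b * qform B v.
  move=> Av; rewrite -!qformZ -qformD; apply: pd; apply: contraNneq Av => ->.
  by rewrite qformx0.
have n1 : qform A v1 != 0 by apply: contraTneq A12 => ->; rewrite mul0r ltxx.
have n2 : qform A v2 != 0 by apply: contraTneq A12 => ->; rewrite mulr0 ltxx.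
have n3 : qform A v3 != 0 by apply: contraTneq A13 => ->; rewrite mulr0 ltxx.
have n4 : qform A v4 != 0 by apply: contraTneq A14 => ->; rewrite mulr0 ltxx.
move: (pos _ n1) (pos _ n2) (pos _ n3) (pos _ n4) A12 A13 A14 B12 B13 B14.
move: (qform A v1) (qform A v2) (qform A v3) (qform A v4).
move: (qform B v1) (qform B v2) (qform B v3) (qform B v4).
move=> y1 y2 y3 y4 x1 x2 x3 x4 p1 p2 p3 p4 A12 A13 A14 B12 B13 B14.
have sgn (c x y : R) : x * y < 0 -> (c * x <= 0) || (c * y <= 0).
  move=> xy; case: leP => //= cx; rewrite leNgt; apply/negP => cy.
  by have : 0 < (c * x) * (c * y) by [rewrite mulr_gt0]; have := sqr_ge0 c; nra.
have sgn2 (c x y : R) : 0 < x * y -> c * x <= 0 -> c * y <= 0.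
  move=> xy cx; rewrite leNgt; apply/negP => cy.
  have c0 : c != 0 by apply: contraTneq cy => ->; rewrite mul0r ltxx.
  have : 0 < c ^+ 2 * (x * y) by rewrite mulr_gt0// exprn_even_gt0.
  have -> : c ^+ 2 * (x * y) = c * x * (c * y) by ring.
  by rewrite ltNge mulr_le0_ge0// ltW.
(* [A] has one sign on [v1, v2] and the other on [v3, v4]. On the pair where [a A <= 0], [B] changes
   sign, so [b B <= 0] at one of its members. *)
have [ax1|ax1] := leP (a * x1) 0.
  have ax2 := sgn2 _ _ _ A12 ax1.
  by have /orP[] := sgn b _ _ B12; lra.
have ax3 : a * x3 <= 0 by have := sgn a _ _ A13; rewrite leNgt ax1.
have ax4 : a * x4 <= 0 by have := sgn a _ _ A14; rewrite leNgt ax1.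
have B34 : y3 * y4 < 0.
  have y10 : y1 != 0 by apply: contraTneq B12 => ->; rewrite mul0r ltxx.
  have y12 : 0 < y1 ^+ 2 by rewrite exprn_even_gt0.
  have : (y1 * y3) * (y1 * y4) < 0 by rewrite pmulr_rlt0.
  by nra.
by have /orP[] := sgn b _ _ B34; lra.
Qed.

End crossing.

(** * The direction along which a translated form crosses the original one *)

Section crossing_direction.
Variables (R : realType) (m : nat).
Implicit Types (A B D : 'M[R]_m) (u v w x : 'cV[R]_m).

Definition dot u v : R := bform 1%:M u v.

Lemma dotE u v : dot u v = (u^T *m v) ord0 ord0.
Proof. by rewrite /dot /bform mulmx1. Qed.

Lemma dotC u v : dot u v = dot v u.
Proof. by apply: bformC; exact: trmx1. Qed.

Lemma dotDr u v w : dot u (v + w) = dot u v + dot u w.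
Proof. by rewrite !dotE mulmxDr mxE. Qed.

Lemma dotZr a u v : dot u (a *: v) = a * dot u v.
Proof. by rewrite !dotE -scalemxAr mxE. Qed.

Lemma dotDl u v w : dot (u + v) w = dot u w + dot v w.
Proof. by rewrite dotC dotDr !(dotC w). Qed.

Lemma dotZl a u v : dot (a *: u) v = a * dot u v.
Proof. by rewrite dotC dotZr dotC. Qed.

(** This is [dot u u] times the component of [w] orthogonal to [u], scaled to avoid a division. *)
Definition reject u w : 'cV[R]_m := dot u u *: w + (- dot u w) *: u.

(* On the plane spanned by [u] and [w] this is a multiple of the product of the
   coordinates dual to [u] and [w], as [reject u w] is orthogonal to [u]. *)
Definition crossdir u w : 'M[R]_m :=
  reject u w *m (reject w u)^T + reject w u *m (reject u w)^T.

Lemma crossdir_sym u w : (crossdir u w)^T = crossdir u w.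
Proof.
by rewrite /crossdir linearD/= !trmx_mul !trmxK addrC.
Qed.

Lemma qform_outer u v x : qform (u *m v^T) x = dot u x * dot v x.
Proof.
rewrite /qform /bform mulmxA -mulmxA mxE big_ord1 -!dotE (dotC x).
by rewrite dotE.
Qed.

(** With [G] the Gram determinant of [u] and [w], the factors [reject u w] and [reject w u] take the
    values [s G] and [G] at [u + s w]. *)
Lemma qform_crossdir u w (s : R) : qform (crossdir u w) (u + s *: w) =
  2 * (dot u u * dot w w - dot u w ^+ 2) ^+ 2 * s.
Proof.
rewrite qformD !qform_outer /reject.
by rewrite !(dotDl, dotDr, dotZl, dotZr) (dotC w u); ring.
Qed.

(** The square norm of [reject u w] is [dot u u] times the Gram determinant. If it vanished, [w]
    would be a multiple of [u], and [A] could not be negative at [w]. *)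
Lemma gram_neq0 A u w : 0 < qform A u -> qform A w < 0 ->
  dot u u * dot w w - dot u w ^+ 2 != 0.
Proof.
move=> Au Aw; apply/eqP => G0.
have u0 : u != 0.
  by apply: contraTneq Au => ->; rewrite qformx0 ltxx.
have : reject u w = 0.
  apply: qform1_eq0; rewrite -[LHS]/(dot (reject u w) (reject u w)) /reject.
  rewrite !(dotDl, dotDr, dotZl, dotZr) (dotC w u).
  rewrite (_ : _ + _ = dot u u * (dot u u * dot w w - dot u w ^+ 2)); last by ring.
  by rewrite G0 mulr0.
rewrite /reject scaleNr => /eqP; rewrite subr_eq0 => /eqP uw.
have uu : 0 < dot u u by exact: qform1_gt0.
have := qform_scale A (dot u u) w; rewrite uw qform_scale.
have : dot u u ^+ 2 * qform A w < 0 by rewrite pmulr_rlt0// exprn_gt0.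
have : 0 <= dot u w ^+ 2 * qform A u by rewrite mulr_ge0 ?sqr_ge0// ltW.
by lra.
Qed.

End crossing_direction.

(** On the line [u + s w] both forms are concave quadratics in [s] with the same positive value at
    0; adding [h D] moves both roots to the right, which opens an interval for each mixed sign
    pair. *)
Lemma crosses_along (R : realType) m (A : 'M[R]_m) (u w : 'cV[rat]_m) (h : R) :
  A^T = A -> 0 < qform A (ratvec R u) -> qform A (ratvec R w) < 0 -> 0 < h ->
  exists M, crosses M A (A + h *: crossdir (ratvec R u) (ratvec R w)).
Proof.
move=> As Au Aw h0; set U := ratvec R u in Au *; set W := ratvec R w in Aw *.
set D := crossdir U W.
have k0 : 0 < 2 * (dot U U * dot W W - dot U W ^+ 2) ^+ 2.
  by rewrite mulr_gt0// exprn_even_gt0// (gram_neq0 Au Aw).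
set k := (X in 0 < X) in k0.
have Dk s : qform D (U + s *: W) = k * s by exact: qform_crossdir.
have hk : 0 < h * k by rewrite mulr_gt0.
have [s1 [s2 [s10 s20 fE]]] := quadratic_roots (bform A U W) Au Aw.
(* On this line [h D] equals [h k s], so half the linear coefficient grows by [h k / 2]. *)
have [t1 [t2 [t10 t20 gE]]] :=
  quadratic_roots (bform A U W + h * k / 2) Au Aw.
have fline (q : rat) : qform A (ratvec R (u + q *: w)) =
    qform A W * (ratr q - s1) * (ratr q - s2).
  by rewrite -ratr_line qform_line// fE.
have gline (q : rat) : qform (A + h *: D) (ratvec R (u + q *: w)) =
    qform A W * (ratr q - t1) * (ratr q - t2).
  by rewrite -ratr_line qformD qformZ Dk qform_line// -gE; field.
(* At a root of [A] the form [A + h D] equals [h k s]: positive at [s2], which therefore lies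
   between [t1] and [t2], and negative at [s1], which, being below [t2], lies below [t1]. *)
have lt2 : s2 < t2.
  have : qform A W * (s2 - t1) * (s2 - t2) = h * k * s2.
    have f0 := fE s2; rewrite subrr mulr0 in f0.
    by apply/subr0_eq; rewrite -gE -[RHS]f0; field.
  move=> e; rewrite -subr_lt0; have : 0 < h * k * s2 by rewrite mulr_gt0.
  by rewrite -e nmulr_rgt0// nmulr_rlt0// subr_gt0 (lt_trans t10).
have lt1 : s1 < t1.
  have : qform A W * (s1 - t1) * (s1 - t2) = h * k * s1.
    have f0 := fE s1; rewrite subrr mulr0 mul0r in f0.
    by apply/subr0_eq; rewrite -gE -[RHS]f0; field.
  move=> e; rewrite -subr_lt0; have : h * k * s1 < 0 by rewrite pmulr_rlt0.
  by rewrite -e mulrAC pmulr_rlt0// nmulr_rgt0// subr_lt0 (lt_trans s10).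
(* The signs of [A] and [A + h D] are (+,+) at 0, (+,-) at [q3], (-,+) at [q2] and (-,-) at [q4]. *)
have [q2] := rat_in_itvoo lt2; rewrite in_itv/= => /andP[q21 q22].
have [q3] := rat_in_itvoo lt1; rewrite in_itv/= => /andP[q31 q32].
have [|q4] := @rat_in_itvoo R (s1 - 1) s1; first by lra.
rewrite in_itv/= => /andP[q41 q42].
have neg3 (x y : R) : x < 0 -> y < 0 -> qform A W * x * y < 0.
  by move=> x0 y0; rewrite nmulr_llt0// nmulr_rgt0.
have pos3 (x y : R) : 0 < x -> y < 0 -> 0 < qform A W * x * y.
  by move=> x0 y0; rewrite nmulr_lgt0// nmulr_rlt0.
have neg3' (x y : R) : 0 < x -> 0 < y -> qform A W * x * y < 0.
  by move=> x0 y0; rewrite pmulr_llt0// nmulr_rlt0.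
apply: (@crosses_of_quadrants R m A (A + h *: D) u (u + q3 *: w)
  (u + q2 *: w) (u + q4 *: w)); rewrite ?fline ?gline //.
- by have := qform_crossdir U W 0; rewrite scale0r addr0 mulr0 qformD qformZ =>
    ->; rewrite mulr0 addr0.
- by apply: pos3; lra.
- by apply: neg3; lra.
- by apply: neg3'; lra.
- by apply: pos3; lra.
- by apply: neg3; lra.
- by apply: neg3; lra.
Qed.

(** * Translation invariance of the iterated Lebesgue integral *)

Section sigma_finite_copy.
Context d (T : measurableType d) (R : realType) (m : {measure set T -> \bar R}).
Hypothesis sf : sigma_finite setT m.

(** Taking the proof as an argument lets the sigma-finite structure be attached to a measure that
    comes from an existential statement. *)
Definition sigma_finite_copy of sigma_finite setT m : set T -> \bar R := m.
Local Notation m' := (sigma_finite_copy sf).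
HB.instance Definition _ := Measure.on m'.
HB.instance Definition _ := Measure_isSigmaFinite.Build _ _ _ m' sf.

End sigma_finite_copy.

Section translation.
Variable R : realType.
Local Notation mu := (@lebesgue_measure R).

Lemma measurable_addl (c : R) :
  measurable_fun [set: measurableTypeR R] (fun x : measurableTypeR R => c + x : measurableTypeR R).
Proof. exact: (measurable_funD (measurable_cst c) (@measurable_id _ _ setT)). Qed.

(** The image of Lebesgue measure under the translation has the right value on half-open intervals,
    and this determines it. *)
Lemma lebesgue_measure_translate (c : R) (A : set (measurableTypeR R)) :
  measurable A -> mu ((fun x => c + x) @^-1` A) = mu A.
Proof.
move=> mA; pose f : measurableTypeR R -> measurableTypeR R := fun x => c + x.
have mf : measurable_fun setT f by exact: measurable_addl.
pose fp : {mfun _ >-> _} := HB.pack f (isMeasurableFun.Build _ _ _ _ f mf).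
apply/esym; apply: (lebesgue_measure_unique (mu := pushforward mu fp)) => //.
move=> _ [[a b]] _ <-; rewrite /= /pushforward (_ : f @^-1` _ = `]a - c, b - c]%classic).
  rewrite !lebesgue_measure_itv/= !lte_fin ltrD2r; case: ifP => // _.
  by rewrite -!EFinB; congr EFin; ring.
by apply/seteqP; split => x /=; rewrite !in_itv/= /f ltrBlDl lerBrDl.
Qed.

Lemma ge0_integral_translate (c : R) (f : measurableTypeR R -> \bar R) :
  measurable_fun setT f -> (forall x, 0 <= f x)%E ->
  (\int[mu]_x f (c + x)%R = \int[mu]_x f x)%E.
Proof.
move=> mf f0; pose g : measurableTypeR R -> measurableTypeR R := fun x => c + x.
have mg : measurable_fun setT g by exact: measurable_addl.
transitivity (\int[pushforward mu g]_x f x)%E.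
  by rewrite (ge0_integral_pushforward mg)//.
by apply: eq_measure_integral => A mA _; exact: lebesgue_measure_translate.
Qed.

Definition tuple_add d (c t : d.-tuple R) : d.-tuple R :=
  [tuple tnth c i + tnth t i | i < d].

Definition cube d (k : nat) : set (d.-tuple R) :=
  [set t | forall i, `|tnth t i| <= k%:R].

Definition cons_pair d (p : measurableTypeR R * d.-tuple (measurableTypeR R)) :
  d.+1.-tuple (measurableTypeR R) := [tuple of p.1 :: p.2].

Lemma measurable_cons_pair d : measurable_fun setT (@cons_pair d).
Proof. exact: measurable_cons. Qed.

Lemma measurable_tuple_add d (c : d.-tuple R) :
  measurable_fun [set: d.-tuple (measurableTypeR R)]
    (tuple_add c : _ -> d.-tuple (measurableTypeR R)).
Proof.
apply/measurable_fun_tnthP => i; rewrite (_ : _ \o _ = fun t => tnth c i + tnth t i).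
  apply: (measurableT_comp (measurable_addl (tnth c i))).
  exact: measurable_tnth.
by apply/funext => t /=; rewrite tnth_mktuple.
Qed.

Lemma tuple_add_cons d c (c' : d.-tuple R) x (t : d.-tuple R) :
  tuple_add [tuple of c :: c'] [tuple of x :: t] =
  [tuple of c + x :: tuple_add c' t].
Proof.
apply: eq_from_tnth => i; rewrite tnth_mktuple.
by case: (unliftP ord0 i) => [j ->|->]; rewrite ?tnthS ?tnth0// tnth_mktuple.
Qed.

Lemma measurable_cube d k : measurable (@cube d k : set (d.-tuple (measurableTypeR R))).
Proof.
rewrite (_ : @cube d k = \bigcap_(i in [set: 'I_d])
    ((fun t => tnth t i) @^-1` `[- k%:R, k%:R])).
  apply: fin_bigcap_measurable => [|i _]; first exact: finite_finset.
  rewrite -[X in measurable X]setTI.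
  by apply: (@measurable_tnth _ (measurableTypeR R) d i) => //; exact: measurable_itv.
apply/seteqP; split => t /= h i; [move=> _|];
  by have := h i; rewrite /= in_itv/= -ler_norml => //; apply.
Qed.

(** By induction on [d], [m] is the image under [cons_pair] of the product of Lebesgue measure with
    the previous [m]; integrating its sections is the recursion that defines [lebesgue_tuple]. *)
Lemma lebesgue_tuple_measure d :
  exists m : {measure set (d.-tuple (measurableTypeR R)) -> \bar R},
  [/\ forall A, measurable A -> m A = @lebesgue_tuple R d A,
      forall k, (m (@cube d k) < +oo)%E &
      forall c (A : set (d.-tuple (measurableTypeR R))), measurable A -> m (tuple_add c @^-1` A) = m A].
Proof.
elim: d => [|d [m [mE mfin mtr]]].
  exists \d_([tuple] : 0.-tuple (measurableTypeR R)); split => //.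
    by move=> k; rewrite /= diracE; case: (_ \in _); rewrite ltry.
  move=> c A mA; rewrite /= !diracE; congr ((_ _)%:R%:E); apply/idP/idP; rewrite !inE/=;
  by rewrite (tuple0 (tuple_add _ _)).
(* Finiteness on cubes is carried through the induction for this: the product needs a sigma-finite
   second factor. *)
have sf : sigma_finite setT m.
  exists (fun k => @cube d k).
    apply/esym/seteqP; split => // t _.
    exists (Num.bound (\sum_i `|tnth t i|)) => // i.
    apply: le_trans (ltW (archi_boundP _)); last by rewrite sumr_ge0.
    by rewrite (bigD1 i)//= lerDl sumr_ge0.
  by move=> k; split; [exact: measurable_cube|exact: mfin].
pose ms : {sigma_finite_measure set (d.-tuple (measurableTypeR R)) -> \bar R} :=
  sigma_finite_copy sf.
exists (pushforward (lebesgue_measure \x ms)%E (@cons_pair d)).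
have mpush A : measurable A ->
    pushforward (lebesgue_measure \x ms)%E (@cons_pair d) A = @lebesgue_tuple R d.+1 A.
  move=> mA; rewrite /= /pushforward /product_measure1.
  apply: eq_integral => x _ /=.
  have mAx : measurable (xsection (@cons_pair d @^-1` A) x).
    apply: measurable_xsection; rewrite -[X in measurable X]setTI.
    exact: measurable_cons_pair.
  rewrite -[LHS]/(m (xsection (@cons_pair d @^-1` A) x)) mE//.
  by congr lebesgue_tuple; apply/seteqP; split => t; rewrite /xsection/= inE.
have mcp A : measurable A -> measurable (@cons_pair d @^-1` A).
  by move=> mA; rewrite -[X in measurable X]setTI; exact: measurable_cons_pair.
split=> //.
  move=> k; rewrite /= /pushforward.
  rewrite (_ : _ @^-1` _ = `[- k%:R, k%:R]%classic `*` @cube d k); last first.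
    apply/seteqP; split => -[x t] /=.
      move=> h; split => /=; first by have := h ord0; rewrite in_itv/= -ler_norml.
      by move=> i; have := h (lift ord0 i); rewrite tnthS.
    move=> [xk tk] i; case: (unliftP ord0 i) => [j ->|->].
      by rewrite tnthS; exact: tk.
    by move: xk; rewrite /= in_itv/= -ler_norml.
  rewrite product_measure1E//; last exact: measurable_cube.
  rewrite lte_mul_pinfty//; last exact: mfin.
  rewrite /= lebesgue_measure_itv/= lte_fin.
  by case: ifP => // _; rewrite -EFinB.
move=> c A mA; rewrite /= /pushforward /product_measure1.
(* The integral absorbs the shift of the first coordinate, and the induction hypothesis that of each
   section. *)
rewrite -[RHS](ge0_integral_translate (thead c)) //; last first.
  by apply: measurable_fun_xsection; exact: mcp.
apply: eq_integral => x _ /=.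
rewrite -[RHS](mtr [tuple of behead c]); last first.
  by apply: measurable_xsection; exact: mcp.
have cE t : tuple_add c (cons_pair (x, t)) =
    cons_pair (thead c + x, tuple_add [tuple of behead c] t).
  by rewrite {1}(tuple_eta c); exact: tuple_add_cons.
rewrite /sigma_finite_copy; congr (Measure.sort m _); apply/seteqP.
by split => t; rewrite /xsection/= !inE/= cE.
Unshelve. exact: measurable_cons_pair.
Qed.

End translation.

(** * Sets with many disjoint translates *)

Lemma measure_vanishing d (T : measurableType d) (R : realType)
    (m : {measure set T -> \bar R}) (F : nat -> set T) (e : R) :
  (forall i, measurable (F i)) -> (m (F 0%N) < +oo)%E ->
  (forall i j, (i <= j)%N -> F j `<=` F i) -> \bigcap_n F n = set0 -> 0 < e ->
  exists n, (m (F n) <= e%:E)%E.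
Proof.
move=> mF F0 ndF capF e0.
have : m \o F @ \oo --> m (\bigcap_n F n).
  apply: nonincreasing_cvg_mu => //; first by rewrite capF.
  by move=> i j ij; apply/subsetPset; exact: ndF.
rewrite capF measure0 => cvF.
have /cvF[n _ nF] : nbhs (0 : \bar R)%E [set x | (x < e%:E)%E].
  by apply: open_nbhs_nbhs; split; [exact: open_ereal_lt_ereal|rewrite /= lte_fin].
by exists n; apply/ltW/(nF n) => /=.
Qed.

Lemma measure_le_cover d (T : measurableType d) (R : realType)
    (m : {measure set T -> \bar R}) (A B : set T) (K : nat) (Z : nat -> set T)
    (x y : R) :
  measurable A -> measurable B -> (forall r, measurable (Z r)) ->
  A `<=` B `|` \big[setU/set0]_(r < K) Z r ->
  (m B <= x%:E)%E -> (forall r, (r < K)%N -> (m (Z r) <= y%:E)%E) ->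
  (m A <= (x + y *+ K)%:E)%E.
Proof.
move=> mA mB mZ ABZ mBx mZy.
have mU : measurable (\big[setU/set0]_(r < K) Z r) by exact: bigsetU_measurable.
apply: (@le_trans _ _ (m (B `|` \big[setU/set0]_(r < K) Z r))).
  by apply: le_measure; rewrite ?inE//; exact: measurableU.
apply: le_trans (measureU2 _ mB mU) _; rewrite EFinD; apply: leeD => //.
apply: le_trans (Boole_inequality _ _) _; first by move=> i _; exact: mZ.
apply: (@le_trans _ _ (\sum_(r < K) y%:E)%E); first by apply: lee_sum => i _; exact: mZy.
by rewrite sumEFin sumr_const card_ord.
Qed.

Section translates.
Variables (R : realType) (d : nat).
Local Notation tupR := (d.-tuple (measurableTypeR R)).
Variable m : {measure set tupR -> \bar R}.
Hypothesis m_cube : forall k, (m (@cube R d k) < +oo)%E.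
Hypothesis m_translate : forall c (A : set tupR), measurable A ->
  m (tuple_add c @^-1` A) = m A.

Definition tuple_scale (h : R) (c : d.-tuple R) : d.-tuple R :=
  [tuple h * tnth c i | i < d].

Definition tuple_move (c : d.-tuple R) (h : R) (t : d.-tuple R) : d.-tuple R :=
  tuple_add (tuple_scale h c) t.

Lemma tuple_moveD c h h' t : tuple_move c (h + h') t = tuple_move c h (tuple_move c h' t).
Proof. by apply: eq_from_tnth => i; rewrite !tnth_mktuple; ring. Qed.

Lemma measurable_tuple_move c h (A : set tupR) : measurable A ->
  measurable (tuple_move c h @^-1` A : set tupR).
Proof.
by move=> mA; rewrite -[X in measurable X]setTI; exact: measurable_tuple_add.
Qed.

(** All shifts [i / K] are below 1, so the translates stay in a cube whose size [b] depends on [a]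
    and [c] but neither on [K] nor on [U]. *)
Lemma disjoint_translates_bound (c : d.-tuple R) (a : nat) : exists b : nat,
  forall (K : nat) (U : set tupR), measurable U -> U `<=` @cube R d a ->
  (forall i k : nat, (i < k < K)%N ->
    [disjoint tuple_move c (i%:R / K%:R) @^-1` U &
              tuple_move c (k%:R / K%:R) @^-1` U]%classic) ->
  (m U *+ K <= m (@cube R d b))%E.
Proof.
exists (a + Num.bound (\sum_i `|tnth c i|))%N => K U mU Ua dU.
pose W i : set tupR := tuple_move c (i%:R / K%:R) @^-1` U.
have mW i : measurable (W i) by exact: measurable_tuple_move.
have : (m (\big[setU/set0]_(i < K) W i) <= m (cube (a + Num.bound (\sum_i `|tnth c i|))))%E.
  apply: le_measure; rewrite ?inE//; [exact: bigsetU_measurable|exact: measurable_cube|].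
  rewrite -bigcup_mkord => t [i /= iK Wt] j.
  have := Ua _ Wt j; rewrite tnth_mktuple tnth_mktuple => tj.
  have -> : tnth t j = (i%:R / K%:R * tnth c j + tnth t j) - i%:R / K%:R * tnth c j by ring.
  apply: le_trans (ler_normB _ _) _; rewrite natrD lerD//.
  apply: le_trans (ltW (archi_boundP _)); last by rewrite sumr_ge0.
  rewrite (bigD1 j)//= normrM (@le_trans _ _ `|tnth c j|)//; last by rewrite lerDl sumr_ge0.
  rewrite ler_piMl// ger0_norm ?divr_ge0// ler_pdivrMr ?mul1r ?ler_nat ?ltr0n.
    exact: ltnW.
  exact: leq_ltn_trans iK.
rewrite measure_semi_additive_ord_I//; last exact: bigsetU_measurable.
  rewrite (eq_bigr (fun=> m U)) => [|i _]; last exact: m_translate.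
  by rewrite big_const_ord iter_addr addr0.
apply/trivIsetP => i j /= iK jK ij.
wlog ltij : i j iK jK ij / (i < j)%N.
  move=> h; have [|ji] := ltnP i j; first exact: h.
  by rewrite setIC h// 1?eq_sym// ltn_neqAle eq_sym ij.
by apply/disj_set2P/dU; rewrite ltij.
Qed.

(** * Bounded sets without incompatible pairs *)

Section incompatible.
(** In the application [E] is the set of nondefinite forms in the unit ball, [N] that of all
    nondefinite forms, and [X M] is [crosses M]. *)
Variables (a : nat) (E N : set tupR).
Hypotheses (mE : measurable E) (mN : measurable N) (EN : E `<=` N).
Hypothesis Ea : E `<=` @cube R d a.
Variable X : nat -> tupR -> tupR -> bool.
Hypothesis X_widen : forall M M' t t', (M <= M')%N -> X M t t' -> X M' t t'.
Hypothesis mX : forall M c, measurable [set t | X M t (tuple_add c t)].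

(* Removing from [U] the points [t] for which some [t + (r/K) c] is not yet
   known to be incompatible with [t] leaves a set with [K] disjoint translates in
   a fixed cube; the removed part vanishes as [M] grows. *)
Lemma incompatible_direction (c : tupR) (G : set tupR) (e : R) : measurable G ->
  (forall t h, E t -> G t -> 0 < h -> N (tuple_move c h t) ->
    exists M, X M t (tuple_move c h t)) ->
  0 < e ->
  exists M, forall U : set tupR, measurable U -> U `<=` E -> U `<=` G ->
    (forall t t', U t -> U t' -> ~~ X M t t') -> (m U <= e%:E)%E.
Proof.
move=> mG inc e0; have [b bP] := disjoint_translates_bound c a.
have mb : m (cube b) \is a fin_num by rewrite ge0_fin_numE.
set V := fine (m (cube b)).
have V0 : 0 <= V by rewrite fine_ge0.
(* With this [K], a set with [K] disjoint translates in the cube of volume [V] has measure at most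
   [e / 2]. *)
pose K := (Num.bound (2 * V / e)).+1.
have K0 : 0 < K%:R :> R by rewrite ltr0n.
have VK : V / K%:R <= e / 2.
  have h0 : 0 <= 2 * V / e by rewrite divr_ge0 ?mulr_ge0// ltW.
  have : 2 * V / e <= K%:R by rewrite (le_trans (ltW (archi_boundP h0)))// ler_nat.
  by rewrite ler_pdivrMr// ler_pdivrMr//; lra.
(* The shift is [r.+1] because two distinct translates differ by at least one step. Each of the [K]
   sets will get measure at most [e / 2 / K]. *)
pose Z r M : set tupR := E `&` G `&` (tuple_move c (r.+1%:R / K%:R) @^-1` N)
  `&` ~` [set t | X M t (tuple_move c (r.+1%:R / K%:R) t)].
have mZ r M : measurable (Z r M).
  apply: measurableI; last by apply: measurableC; exact: mX.
  by apply: measurableI; [exact: measurableI|exact: measurable_tuple_move].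
have Efin : (m E < +oo)%E.
  by apply: le_lt_trans (m_cube a); apply: le_measure; rewrite ?inE//;
    exact: measurable_cube.
have /choice[f fP] r : exists M, (m (Z r M) <= (e / 2 / K%:R)%:E)%E.
  apply: measure_vanishing.
  - by move=> M; exact: mZ.
  - apply: le_lt_trans Efin; apply: le_measure; rewrite ?inE//.
    by move=> t [[[]]].
  - by move=> i j ij t [ht nt]; split=> //; apply: contra_not nt; exact: X_widen.
  - rewrite -subset0 => t Zt; have [[[Et Gt] Nt] _] := Zt 0%N I.
    have [|M XM] := inc t (r.+1%:R / K%:R) Et Gt _ Nt; first by rewrite divr_gt0.
    by have [_] := Zt M I; apply.
  - by rewrite !divr_gt0.
exists (\max_(r < K) f r) => U mU UE UG XU.
pose Z' := \big[setU/set0]_(r < K) Z r (f r).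
have mZ' : measurable Z' by apply: bigsetU_measurable => r _; exact: mZ.
pose U' := U `\` Z'.
have mU' : measurable U' by exact: measurableD.
have := bP K U' mU' (fun t Ut => Ea (UE t Ut.1)).
move=> /(_ _)/wrap[].
  (* A common point gives two points of [U] that differ by [(k - i) / K] times [c]; as they are
     compatible at level [M], the first was removed with [Z']. *)
  move=> i k /andP[ik kK]; apply/disj_set2P; rewrite -subset0 => t [[Ui nZi] [Uk _]].
  apply: nZi; rewrite /Z' -(bigcup_mkord K (fun r => Z r (f r))); exists (k - i).-1.
    by rewrite /= prednK ?subn_gt0// (leq_trans _ (ltnW kK))// leq_subr.
  have kE : tuple_move c ((k - i).-1.+1%:R / K%:R) (tuple_move c (i%:R / K%:R) t) =
      tuple_move c (k%:R / K%:R) t.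
    rewrite -tuple_moveD -mulrDl -natrD prednK ?subn_gt0// subnK//.
    exact: ltnW.
  split; first split; first by split; [exact: UE|exact: UG].
    by rewrite /= kE; apply/EN/UE.
  rewrite /= kE => XM; have := XU _ _ Ui Uk; rewrite (X_widen _ XM)//.
  have rK : ((k - i).-1 < K)%N by rewrite prednK ?subn_gt0// (leq_trans _ (ltnW kK))// leq_subr.
  exact: (@leq_bigmax _ (fun r : 'I_K => f r) (Ordinal rK)).
move=> UV.
have U'fin : m U' \is a fin_num.
  rewrite ge0_fin_numE//; apply: le_lt_trans Efin; apply: le_measure; rewrite ?inE//.
  by move=> t [Ut _]; exact: UE.
have mU'e : (m U' <= (e / 2)%:E)%E.
  rewrite -(fineK U'fin) lee_fin; apply: le_trans VK; rewrite ler_pdivlMr//.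
  move: UV; rewrite -(fineK U'fin) -(fineK mb) -EFin_natmul lee_fin.
  by rewrite mulr_natr.
have -> : e = e / 2 + (e / 2 / K%:R) *+ K by rewrite -mulr_natr; field; rewrite gt_eqF.
apply: (measure_le_cover (Z := fun r => Z r (f r)) mU mU') => //.
by move=> t Ut; have [Zt|nZt] := pselect (Z' t); [right|left].
Qed.

(** By continuity of the measure, finitely many [G j] cover [E] up to measure [e / 2];
    [incompatible_direction] handles the part of [U] in each of them. *)
Lemma incompatible_small (c : nat -> tupR) (G : nat -> set tupR) (e : R) :
  (forall j, measurable (G j)) -> E `<=` \bigcup_j G j ->
  (forall j t h, E t -> G j t -> 0 < h -> N (tuple_move (c j) h t) ->
    exists M, X M t (tuple_move (c j) h t)) ->
  0 < e ->
  exists M, forall U : set tupR, measurable U -> U `<=` E ->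
    (forall t t', U t -> U t' -> ~~ X M t t') -> (m U <= e%:E)%E.
Proof.
move=> mG EG inc e0.
have Efin : (m E < +oo)%E.
  by apply: le_lt_trans (m_cube a); apply: le_measure; rewrite ?inE//;
    exact: measurable_cube.
pose F J : set tupR := E `\` \big[setU/set0]_(j < J) G j.
have mF J : measurable (F J).
  by apply: measurableD => //; apply: bigsetU_measurable => j _; exact: mG.
have [J FJ] : exists J, (m (F J) <= (e / 2)%:E)%E.
  apply: measure_vanishing => //.
  - apply: le_lt_trans Efin; apply: le_measure; rewrite ?inE//.
    by move=> t [].
  - move=> i j ij t; rewrite /F -!bigcup_mkord => -[Et nt]; split => // -[k /= ki Gk].
    by apply: nt; exists k => //=; exact: leq_trans ij.
  - rewrite -subset0 => t Ft; have [Et _] := Ft 0%N I; have [j _ Gj] := EG _ Et.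
    have [_] := Ft j.+1 I; apply; rewrite -bigcup_mkord; exists j => //=.
  - by rewrite divr_gt0.
(* The other half of [e] is shared by [J] sets; the divisor [J.+1] is nonzero even for [J = 0]. *)
have /choice[f fP] j := incompatible_direction (mG j) (inc j)
  (divr_gt0 (divr_gt0 e0 (ltr0n R 2)) (ltr0Sn R J)).
exists (\max_(j < J) f j) => U mU UE XU.
apply: (@le_trans _ _ (e / 2 + (e / 2 / J.+1%:R) *+ J)%:E).
  apply: (measure_le_cover (B := F J) (Z := fun j => U `&` G j)) => //.
  - by move=> j; exact: measurableI.
  - move=> t Ut; have [Gt|nGt] := pselect ((\big[setU/set0]_(j < J) G j) t).
      right; move: Gt; rewrite -bigcup_mkord => -[j /= jJ Gj].
      by rewrite -(bigcup_mkord J (fun j => U `&` G j)); exists j.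
    by left; split => //; exact: UE.
  - move=> j jJ; apply: (fP j).
    + exact: measurableI.
    + by move=> t [Ut _]; exact: UE.
    + by move=> t [].
    + move=> t t' [Ut _] [Ut' _]; apply: contra (XU _ _ Ut Ut'); apply: X_widen.
      exact: (@leq_bigmax _ (fun r : 'I_J => f r) (Ordinal jJ)).
have : e / 2 / J.+1%:R *+ J <= e / 2.
  rewrite -mulr_natr mulrAC ler_pdivrMr ?ltr0Sn//.
  by rewrite ler_pM2l ?divr_gt0// ler_nat.
by move=> h; rewrite lee_fin (le_trans (lerD (lexx _) h))// -splitr.
Qed.

End incompatible.
End translates.

(** * Coordinates on symmetric matrices *)

Definition tri_index (i j : nat) : nat := ('C((maxn i j).+1, 2) + minn i j)%N.

Lemma binS2 k : ('C(k.+1, 2) = 'C(k, 2) + k)%N.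
Proof. by rewrite binS bin1. Qed.

Lemma leq_bin2 j k : (j <= k)%N -> ('C(j, 2) <= 'C(k, 2))%N.
Proof. by move=> jk; exact: leq_bin2l. Qed.

Lemma tri_indexE i j : (i <= j)%N -> tri_index i j = ('C(j.+1, 2) + i)%N.
Proof. by move=> ij; rewrite /tri_index (maxn_idPr ij) (minn_idPl ij). Qed.

Lemma tri_indexC i j : tri_index i j = tri_index j i.
Proof. by rewrite /tri_index maxnC minnC. Qed.

Lemma ltn_tri_index i j n : (i <= n)%N -> (j <= n)%N ->
  (tri_index i j < (quadN n).+1)%N.
Proof.
move=> im jm; have mn : (maxn i j <= n)%N by rewrite geq_max im.
have := leq_bin2 (mn : (maxn i j).+1 <= n.+1)%N.
have : (minn i j <= maxn i j)%N by lia.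
rewrite /quadN /tri_index (binS2 n.+1); lia.
Qed.

(** Column [j] occupies the [j + 1] ranks that start at ['C(j.+1, 2)], and these blocks are
    disjoint. *)
Lemma tri_index_inj i j i' j' : (i <= j)%N -> (i' <= j')%N ->
  tri_index i j = tri_index i' j' -> i = i' /\ j = j'.
Proof.
move=> ij ij'; rewrite !tri_indexE// => e.
have jj' : j = j'.
  case: (ltngtP j j') => // lt.
  - by have := leq_bin2 (lt : j.+2 <= j'.+1)%N; rewrite (binS2 j.+1); lia.
  - by have := leq_bin2 (lt : j'.+2 <= j.+1)%N; rewrite (binS2 j'.+1); lia.
by split=> //; move: e; rewrite jj'; lia.
Qed.

(** Passing from [n] to [n.+1] appends one column, whose ranks start at ['C(n.+2, 2)]. *)
Lemma tri_index_surj n k : (k < (quadN n).+1)%N ->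
  exists i j, [/\ (i <= j)%N, (j <= n)%N & k = tri_index i j].
Proof.
rewrite /quadN; elim: n => [|n IH] k_lt.
  by exists 0%N, 0%N; split => //; case: k k_lt.
have [k_lt'|k_ge] := ltnP k ('C(n.+2, 2) - 1).+1.
  have [i [j [ij jn ->]]] := IH k_lt'; exists i, j; split => //; lia.
have b0 : (0 < 'C(n.+2, 2))%N by rewrite bin_gt0.
exists (k - 'C(n.+2, 2))%N, n.+1; move: k_lt; rewrite (binS2 n.+2) => k_lt.
by split; rewrite ?tri_indexE; lia.
Qed.

Section symmetric_matrices.
Variables (R : realType) (n : nat).
Local Notation tupN := ((quadN n).+1.-tuple R).
Local Notation mtupN := ((quadN n).+1.-tuple (measurableTypeR R)).
Local Notation sym t := (@sym_of_tuple R n t).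

Lemma sym_of_tupleE (t : tupN) (i j : 'I_n.+1) :
  sym t i j = tnth t (Ordinal (ltn_tri_index (leq_ord i) (leq_ord j))).
Proof. by rewrite mxE (tnth_nth 0). Qed.

Lemma sym_of_tuple_sym (t : tupN) : (sym t)^T = sym t.
Proof. by apply/matrixP => i j; rewrite !mxE maxnC minnC. Qed.

Lemma sym_of_tuple_add (c t : tupN) : sym (tuple_add c t) = sym c + sym t.
Proof. by apply/matrixP => i j; rewrite [RHS]mxE !sym_of_tupleE tnth_mktuple. Qed.

Lemma sym_of_tuple_move (c : tupN) h (t : tupN) :
  sym (tuple_move c h t) = sym t + h *: sym c.
Proof.
apply/matrixP => i j; rewrite [RHS]mxE [X in _ = _ + X]mxE !sym_of_tupleE.
by rewrite !tnth_mktuple addrC.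
Qed.

Lemma sym_of_tuple_surj (D : 'M[R]_n.+1) : D^T = D -> exists t, sym t = D.
Proof.
move=> Ds.
have /choice[f fP] (k : 'I_(quadN n).+1) : exists x : R, forall i j : 'I_n.+1,
    tri_index i j = k -> x = D i j.
  have [i [j [ij jn kE]]] := tri_index_surj (ltn_ord k).
  have im : (i < n.+1)%N by apply: leq_ltn_trans ij _.
  exists (D (Ordinal im) (Ordinal (jn : j < n.+1)%N)) => i' j'; rewrite kE.
  wlog ij' : i' j' / (i' <= j')%N => [H e|].
    have [le|ji] := leqP i' j'; first exact: H.
    by rewrite -[in RHS]Ds mxE; apply: H; rewrite ?(ltnW ji)// tri_indexC.
  by move=> /(tri_index_inj ij' ij)[ei ej]; congr (D _ _); exact/val_inj.
exists [tuple f k | k < _]; apply/matrixP => i j.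
by rewrite sym_of_tupleE tnth_mktuple; exact: fP.
Qed.

Lemma frobenius_sum (A : 'M[R]_n.+1) :
  frobenius A A = \sum_j \sum_i A i j ^+ 2.
Proof.
rewrite /frobenius /mxtrace; apply: eq_bigr => j _; rewrite mxE.
by apply: eq_bigr => i _; rewrite mxE expr2.
Qed.

Lemma frobenius_cube (t : tupN) : frobenius (sym t) (sym t) <= 1 -> cube 1 t.
Proof.
move=> f1 k; have [i [j [ij jn kE]]] := tri_index_surj (ltn_ord k).
have im : (i < n.+1)%N by apply: leq_ltn_trans ij _.
have <- : sym t (Ordinal im) (Ordinal (jn : j < n.+1)%N) = tnth t k.
  by rewrite sym_of_tupleE; congr tnth; apply/val_inj; rewrite /= kE.
rewrite -(@ler_pXn2r _ 2)// ?nnegrE// expr1n real_normK ?num_real//.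
apply: le_trans f1; rewrite frobenius_sum.
rewrite (bigD1 (Ordinal (jn : j < n.+1)%N))//= (bigD1 (Ordinal im))//=.
rewrite -addrA lerDl addr_ge0// ?sumr_ge0// => *; rewrite ?sumr_ge0// => *;
  exact: sqr_ge0.
Qed.

Lemma measurable_sym_entry i j :
  measurable_fun [set: mtupN] (fun t => sym t i j : R).
Proof.
under eq_fun do rewrite sym_of_tupleE.
exact: measurable_tnth.
Qed.

Lemma measurable_qform_sym v :
  measurable_fun [set: mtupN] (fun t => qform (sym t) v : R).
Proof.
rewrite /qform; under eq_fun do rewrite bformE.
apply: measurable_sum => i; apply: measurable_sum => j.
apply: measurable_funM => //; apply: measurable_funM => //.
exact: measurable_sym_entry.
Qed.

Lemma measurable_frobenius_le1 :
  measurable ([set t | frobenius (sym t) (sym t) <= 1] : set mtupN).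
Proof.
rewrite -[X in measurable X]setTI.
have : measurable_fun [set: mtupN] (fun t => frobenius (sym t) (sym t) : R).
  under eq_fun do rewrite frobenius_sum.
  apply: measurable_sum => j; apply: measurable_sum => i.
  by apply: measurable_funX; exact: measurable_sym_entry.
move=> mf; rewrite (_ : [set t | _] = (fun t => frobenius (sym t) (sym t)) @^-1` `]-oo, 1]).
  by apply: mf => //; exact: measurable_itv.
by apply/seteqP; split => t /=; rewrite in_itv.
Qed.

Lemma measurable_qform_pos v : measurable ([set t | 0 < qform (sym t) v] : set mtupN).
Proof.
rewrite -[X in measurable X]setTI.
rewrite (_ : [set t | _] = (fun t => qform (sym t) v) @^-1` `]0, +oo[).
  by apply: measurable_qform_sym => //; exact: measurable_itv.
by apply/seteqP; split => t /=; rewrite in_itv/= andbT.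
Qed.

Lemma measurable_qform_neg v : measurable ([set t | qform (sym t) v < 0] : set mtupN).
Proof.
rewrite -[X in measurable X]setTI.
rewrite (_ : [set t | _] = (fun t => qform (sym t) v) @^-1` `]-oo, 0[).
  by apply: measurable_qform_sym => //; exact: measurable_itv.
by apply/seteqP; split => t /=; rewrite in_itv.
Qed.

(** Only countably many conditions appear on the right, which gives measurability. *)
Lemma posdef_ratP (A : 'M[R]_n.+1) : posdef A <-> exists k : nat, forall i : nat,
  qform 1%:M (ratvec_nth R n.+1 i) <= k%:R * qform A (ratvec_nth R n.+1 i).
Proof.
split=> [/posdef_bounded_below[k _ Ak]|[k Ak]]; first by exists k.
by apply: (@posdef_of_rat _ _ _ k%:R) => // q; rewrite -ratvec_nth_pickle.
Qed.

Lemma measurable_posdef_scale (a : R) :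
  measurable ([set t | posdef (a *: sym t)] : set mtupN).
Proof.
rewrite (_ : [set t | _] = \bigcup_k \bigcap_i
    [set t | qform 1%:M (ratvec_nth R n.+1 i) <=
             k%:R * qform (a *: sym t) (ratvec_nth R n.+1 i)]).
  apply: bigcupT_measurable => k; apply: bigcapT_measurable => i.
  rewrite -[X in measurable X]setTI.
  set v := ratvec_nth _ _ _.
  have mf : measurable_fun [set: mtupN] (fun t => k%:R * a * qform (sym t) v : R).
    by apply: measurable_funM => //; exact: measurable_qform_sym.
  rewrite (_ : [set t | _] = (fun t => k%:R * a * qform (sym t) v) @^-1`
    `[qform 1%:M v, +oo[); first by apply: mf => //; exact: measurable_itv.
  by apply/seteqP; split => t /=; rewrite in_itv/= andbT qformZ mulrA.
apply/seteqP; split => t /=.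
  by move=> /posdef_ratP[k tk]; exists k => // i _; exact: tk.
by move=> [k _ tk]; apply/posdef_ratP; exists k => i; exact: tk.
Qed.

(** Both signs are excluded since a class determines its matrices only up to a nonzero, possibly
    negative, factor. *)
Definition nondefinite (A : 'M[R]_n.+1) := ~ posdef A /\ ~ posdef (- A).

Lemma measurable_nondefinite : measurable ([set t | nondefinite (sym t)] : set mtupN).
Proof.
apply: measurableI; apply: measurableC.
  by have := measurable_posdef_scale 1; under eq_fun do rewrite scale1r.
by have := measurable_posdef_scale (-1); under eq_fun do rewrite scaleN1r.
Qed.

Lemma measurable_crosses M (c : mtupN) :
  measurable ([set t | crosses M (sym t) (sym (tuple_add c t))] : set mtupN).
Proof.
have mq v : measurable_fun [set: mtupN] (fun t => qform (sym t) v : R).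
  exact: measurable_qform_sym.
have mqc v : measurable_fun [set: mtupN] (fun t => qform (sym (tuple_add c t)) v : R).
  under eq_fun do rewrite sym_of_tuple_add qformD.
  by apply: measurable_funD.
have mx v1 v2 v3 v4 : measurable ([set t | crossing_at (sym t)
    (sym (tuple_add c t)) v1 v2 v3 v4] : set mtupN).
  have : measurable_fun [set: mtupN] (fun t =>
      crossing_at (sym t) (sym (tuple_add c t)) v1 v2 v3 v4).
    by rewrite /crossing_at; do !apply: measurable_and;
      apply: measurable_fun_ltr => //; apply: measurable_funM.
  by move=> /(_ measurableT [set true] I); rewrite setTI.
rewrite (_ : [set t | _] =
    \bigcup_(i in [set: 'I_M * 'I_M * ('I_M * 'I_M)]) [set t |
      crossing_at (sym t) (sym (tuple_add c t)) (ratvec_nth R n.+1 i.1.1)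
        (ratvec_nth R n.+1 i.1.2) (ratvec_nth R n.+1 i.2.1)
        (ratvec_nth R n.+1 i.2.2)]).
  by apply: fin_bigcup_measurable => [|i _]; [exact: finite_finset|exact: mx].
apply/seteqP; split => t /=.
  by move=> /crossesP[i1 [i2 [i3 [i4 h]]]]; exists ((i1, i2), (i3, i4)).
by move=> [[[i1 i2] [i3 i4]] _ h]; apply/crossesP; exists i1, i2, i3, i4.
Qed.

End symmetric_matrices.

Lemma posdef_add_scalar (R : realType) n (A : 'M[R]_n.+1) (h : R) : 0 < h ->
  (forall q : 'cV[rat]_n.+1, 0 <= qform A (ratvec R q)) -> posdef (A + h *: 1%:M).
Proof.
move=> h0 A0 x x0; rewrite -[ltRHS]/(qform _ x) qformD qformZ.
by rewrite ltr_wpDl ?mulr_gt0 ?qform1_gt0//; exact: qform_rat_ge0.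
Qed.

(** * Sets of pairwise non-crossing forms have small measure *)

Section noncrossing.
Variables (R : realType) (n : nat).
Local Notation mtupN := ((quadN n).+1.-tuple (measurableTypeR R)).
Local Notation sym t := (@sym_of_tuple R n t).
Local Notation dirs := (('cV[rat]_n.+1 * 'cV[rat]_n.+1) + bool)%type.

(** Pairs of rational vectors serve the forms that take both signs, the booleans the semidefinite
    ones. The index type is countable, as [incompatible_small] takes a sequence of directions. *)
Definition dir_mx (x : dirs) : 'M[R]_n.+1 :=
  match x with
  | inl uw => crossdir (ratvec R uw.1) (ratvec R uw.2)
  | inr true => 1%:M
  | inr false => - 1%:M
  end.

(* The forms for which translation along [dir_mx x] produces a crossing or a
   definite form. *)
Definition dir_dom (x : dirs) : set mtupN :=
  match x with
  | inl uw => [set t | 0 < qform (sym t) (ratvec R uw.1)] `&`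
              [set t | qform (sym t) (ratvec R uw.2) < 0]
  | inr true => \bigcap_i ~` [set t | qform (sym t) (ratvec_nth R n.+1 i) < 0]
  | inr false => \bigcap_i ~` [set t | 0 < qform (sym t) (ratvec_nth R n.+1 i)]
  end.

Lemma measurable_dir_dom x : measurable (dir_dom x).
Proof.
case: x => [[u w]|[]] /=.
- apply: measurableI; [exact: measurable_qform_pos|exact: measurable_qform_neg].
- apply: bigcapT_measurable => i; apply: measurableC; exact: measurable_qform_neg.
- apply: bigcapT_measurable => i; apply: measurableC; exact: measurable_qform_pos.
Qed.

Lemma dir_mx_sym x : (dir_mx x)^T = dir_mx x.
Proof.
case: x => [[u w]|[]] /=; [exact: crossdir_sym|exact: trmx1|].
by rewrite linearN/= trmx1.
Qed.

Lemma dir_dom_cover (t : mtupN) : exists x, dir_dom x t.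
Proof.
have [[u tu]|nu] := pselect (exists u, 0 < qform (sym t) (ratvec R u)); last first.
  by exists (inr false) => i _ /= ti; apply: nu; exists (odflt 0 (unpickle i)).
have [[w tw]|nw] := pselect (exists w, qform (sym t) (ratvec R w) < 0); last first.
  by exists (inr true) => i _ /= ti; apply: nw; exists (odflt 0 (unpickle i)).
by exists (inl (u, w)).
Qed.

Lemma dir_domP x (t : mtupN) h : dir_dom x t -> 0 < h ->
  nondefinite (sym t + h *: dir_mx x) ->
  exists M, crosses M (sym t) (sym t + h *: dir_mx x).
Proof.
case: x => [[u w] [/= tu tw] h0 _|[] /= tx h0 [nd1 nd2]].
- by apply: crosses_along => //; exact: sym_of_tuple_sym.
- exfalso; apply: nd1; apply: posdef_add_scalar => // q.
  by rewrite -ratvec_nth_pickle leNgt; apply/negP; exact: tx.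
- exfalso; apply: nd2; rewrite opprD -scalerN opprK.
  apply: posdef_add_scalar => // q; rewrite qformN oppr_ge0.
  by rewrite -ratvec_nth_pickle leNgt; apply/negP; exact: tx.
Qed.

Lemma noncrossing_small (m : {measure set mtupN -> \bar R}) (e : R) :
  (forall k, (m (@cube R _ k) < +oo)%E) ->
  (forall c (A : set mtupN), measurable A -> m (tuple_add c @^-1` A) = m A) ->
  0 < e ->
  exists M, forall U : set mtupN, measurable U ->
    U `<=` [set t | frobenius (sym t) (sym t) <= 1 /\ nondefinite (sym t)] ->
    (forall t t', U t -> U t' -> ~~ crosses M (sym t) (sym t')) ->
    (m U <= e%:E)%E.
Proof.
move=> m_cube m_tr e0.
have /choice[c cP] (x : dirs) : exists c : mtupN, sym c = dir_mx x.
  exact/sym_of_tuple_surj/dir_mx_sym.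
(* The default repeats a valid direction, so [dir_domP] still applies at numbers that code
   nothing. *)
pose oc (j : nat) := odflt (inr true) (unpickle j : option dirs).
apply: (@incompatible_small R _ m m_cube m_tr 1 _
  [set t | nondefinite (sym t)] _ _ _ _
  (fun M t t' => crosses M (sym t) (sym t')) _ _ (c \o oc) (dir_dom \o oc)) => //.
- by apply: measurableI; [exact: measurable_frobenius_le1|exact: measurable_nondefinite].
- exact: measurable_nondefinite.
- by move=> t [].
- by move=> t [/frobenius_cube].
- by move=> M M' t t'; exact: crosses_widen.
- by move=> M c'; exact: measurable_crosses.
- by move=> j; exact: measurable_dir_dom.
- move=> t _; have [x xt] := dir_dom_cover t; exists (pickle x) => //=.
  by rewrite /oc pickleK.
- move=> j t h _ /= tj h0; rewrite sym_of_tuple_move cP; exact: dir_domP.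
Qed.

End noncrossing.

(** * Projective classes and sign cells *)

Section projective_classes.
Variables (R : realType) (n : nat).
Implicit Types (p : projQuad R n) (A B : 'M[R]_n.+1).

Lemma proj_classP (Q Q' : nzsym R n) : proj_class Q = proj_class Q' <->
  exists2 c, c != 0 & nzsym_mx Q' = c *: nzsym_mx Q.
Proof.
split=> [|h]; first by move=> /eqmodP /asboolP.
by apply/eqmodP/asboolP.
Qed.

Lemma proj_class_surj p : exists Q, proj_class Q = p.
Proof. by exists (generic_quotient.repr p); exact: generic_quotient.reprK. Qed.

Definition to_nzsym A (As : A^T = A) (A0 : A != 0) : nzsym R n :=
  exist _ A (mem_set (conj As A0)).

Lemma rep_scale p A c : rep p A -> c != 0 -> rep p (c *: A).
Proof.
move=> [Q <- ->] c0; have := set_valP Q; rewrite -/(nzsym_mx Q) => -[Qs Q0].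
have cs : (c *: nzsym_mx Q)^T = c *: nzsym_mx Q by rewrite linearZ/= Qs.
have cn0 : c *: nzsym_mx Q != 0 by rewrite scaler_eq0 negb_or c0.
exists (to_nzsym cs cn0) => //; apply/esym/proj_classP.
by exists c.
Qed.

Lemma rep_prop p A B : rep p A -> rep p B -> exists2 c, c != 0 & B = c *: A.
Proof. by move=> [Q <- ->] [Q' e ->]; exact: (proj_classP _ _).1 (esym e). Qed.

Lemma rep_exists p : exists A, rep p A.
Proof.
by have [Q <-] := proj_class_surj p; exists (nzsym_mx Q); exists Q.
Qed.

Lemma rep_sym p A : rep p A -> A^T = A /\ A != 0.
Proof. by move=> [Q _ ->]; have := set_valP Q. Qed.

Lemma rep_of A : A^T = A -> A != 0 -> exists p, rep p A.
Proof.
by move=> As A0; exists (proj_class (to_nzsym As A0)), (to_nzsym As A0).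
Qed.

(** In the quotient topology openness is tested on the preimage in [nzsym]: the trace of the union,
    over [c != 0], of the open sets of [A] with [c A] in [W]. *)
Lemma open_rep (W : set 'M[R]_n.+1) : open W ->
  open [set p | exists2 A, rep p A & W A].
Proof.
move=> oW; rewrite /open/= /quotient_open.
pose V : set 'M[R]_n.+1 := \bigcup_(c in [set c : R | c != 0]) [set A | W (c *: A)].
have oV : open V.
  apply: bigcup_open => c _.
  by have /continuousP/(_ _ oW) := @scaler_continuous _ 'M[R]_n.+1 c.
exists V => //; apply/seteqP; split => Q /=.
  move=> [c c0 WcQ]; exists (c *: nzsym_mx Q) => //.
  by apply: rep_scale => //; exists Q.
move=> [A QA WA]; have [c c0 AE] := rep_prop (ex_intro2 _ _ Q erefl erefl) QA.
by exists c => //=; rewrite -AE.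
Qed.

Lemma measurable_rep (W : set 'M[R]_n.+1) : open W ->
  measurable ([set p | exists2 A, rep p A & W A] : set (borelQuad R n)).
Proof. by move=> oW; apply: sub_sigma_algebra; exact: open_rep. Qed.

Lemma open_posdef_add (C : 'M[R]_n.+1) : open [set A : 'M[R]_n.+1 | posdef (A + C)].
Proof.
rewrite openE => A /= pA; have [e e0 eP] := posdef_near pA.
apply/nbhs_ballP; exists e => //= B [_ AB]; apply: eP => i j.
by rewrite !mxE opprD addrACA subrr addr0; exact: AB.
Qed.

Lemma qform_mx_continuous (v : 'cV[R]_n.+1) :
  continuous (fun A : 'M[R]_n.+1 => qform A v).
Proof.
rewrite /qform (_ : (fun A => _) = fun A : 'M[R]_n.+1 =>
   \sum_i \sum_j v i ord0 * A i j * v j ord0); last first.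
  by apply/funext => A; rewrite bformE.
apply: continuous_sum => i; apply: continuous_sum => j A.
have ce : continuous (fun A : 'M[R]_n.+1 => A i j) by exact: coord_continuous.
exact: (cvgMr_tmp (cvgMl_tmp (ce A))).
Qed.

Lemma posdef_quadricsN p A : rep p A -> ~ posdef_quadrics p -> nondefinite A.
Proof.
move=> pA np; split=> pd; apply: np; first by exists A.
by exists (- A) => //; rewrite -scaleN1r; apply: rep_scale; rewrite // oppr_eq0 oner_eq0.
Qed.

Lemma nondefinite_class p A : rep p A -> nondefinite A -> ~ posdef_quadrics p.
Proof.
move=> pA [A1 A2] [B pB pdB]; have [c c0 BE] := rep_prop pA pB.
have [cpos|cneg] := ltP 0 c.
  apply: A1 => x x0; have := pdB x x0; rewrite -[ltRHS]/(qform B x) BE qformZ.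
  by rewrite pmulr_rgt0.
have {c0 cneg} c0 : c < 0 by rewrite lt_neqAle c0.
apply: A2 => x x0; have := pdB x x0; rewrite -[ltRHS]/(qform B x) BE qformZ.
by rewrite nmulr_rgt0// => Ax; rewrite -[ltRHS]/(qform (- A) x) qformN oppr_gt0.
Qed.

(** Signs of products of two values, unlike signs of values, are unchanged by a nonzero factor, so
    they descend to classes; a zero product is recorded as [(false, false)]. *)
Definition signs (M : nat) A : {ffun 'I_M * 'I_M -> bool * bool} :=
  [ffun ij : 'I_M * 'I_M => let x := qform A (ratvec_nth R n.+1 ij.1) *
                       qform A (ratvec_nth R n.+1 ij.2) in (0 < x, x < 0)].

Lemma signs_scale M A c : c != 0 -> signs M (c *: A) = signs M A.
Proof.
move=> c0; apply/ffunP => ij; rewrite !ffunE /= !qformZ mulrACA -expr2.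
have c2 : 0 < c ^+ 2 by rewrite exprn_even_gt0.
by rewrite pmulr_rgt0// pmulr_rlt0.
Qed.

Definition signs_cross M (s t : {ffun 'I_M * 'I_M -> bool * bool}) : bool :=
  [exists i : 'I_M * 'I_M * ('I_M * 'I_M),
    [&& (s (i.1.1, i.1.2)).1, (s (i.1.1, i.2.1)).2, (s (i.1.1, i.2.2)).2,
        (t (i.1.1, i.1.2)).2, (t (i.1.1, i.2.1)).1 & (t (i.1.1, i.2.2)).2]].

Lemma signs_crossE M A B : signs_cross (signs M A) (signs M B) = crosses M A B.
Proof.
apply/existsP/crossesP => [[[[i1 i2] [i3 i4]]]|[i1 [i2 [i3 [i4 h]]]]].
  by rewrite !ffunE /= => h; exists i1, i2, i3, i4.
by exists ((i1, i2), (i3, i4)); rewrite !ffunE.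
Qed.

(** Every class has a matrix, so the default 0 is never taken, and [signs_scale] makes the choice
    irrelevant. *)
Definition class_signs M p : {ffun 'I_M * 'I_M -> bool * bool} :=
  signs M (xget 0 (rep p)).

Lemma class_signsE M p A : rep p A -> class_signs M p = signs M A.
Proof.
move=> pA; rewrite /class_signs; case: xgetP => [B _ pB|/(_ A)//].
by have [c c0 ->] := rep_prop pA pB; exact: signs_scale.
Qed.

Definition sign_cell M (F : {set {ffun 'I_M * 'I_M -> bool * bool}}) :
  set (projQuad R n) := [set p | ~ posdef_quadrics p /\ class_signs M p \in F].

Lemma measurable_posdef_quadrics :
  measurable (@posdef_quadrics R n : set (borelQuad R n)).
Proof.
rewrite [X in measurable X](_ : _ = [set p | exists2 A, rep p A &
    [set A : 'M[R]_n.+1 | posdef (A + 0)] A]).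
  by apply: measurable_rep; exact: open_posdef_add.
by apply/seteqP; split => p [A pA] pdA; exists A => //; move: pdA; rewrite /= addr0.
Qed.

Lemma measurable_sign_cell M F : measurable (@sign_cell M F : set (borelQuad R n)).
Proof.
(* A boolean function of classes that amounts to an open condition on matrices has both level sets
   measurable. *)
have mset b (W : set 'M[R]_n.+1) (s : projQuad R n -> bool) : open W ->
    (forall p A, rep p A -> s p <-> W A) ->
    measurable ([set p | s p = b] : set (borelQuad R n)).
  move=> oW sW; have mW := measurable_rep oW.
  suff sE : [set p | exists2 A, rep p A & W A] = [set p | s p].
    case: b; first by rewrite -sE.
    have /measurableC := mW; rewrite sE; congr measurable.
    by apply/seteqP; split => p /=; [move/negP/negbTE|move=> ->].
  apply/seteqP; split => p /=; first by move=> [A pA WA]; apply/(sW p A).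
  by have [A pA] := rep_exists p; move=> /(sW p A pA); exists A.
have prodc v w : continuous (fun A : 'M[R]_n.+1 => qform A v * qform A w).
  by move=> A; exact: (cvgM (@qform_mx_continuous v A) (@qform_mx_continuous w A)).
apply: measurableI.
  by apply: measurableC; exact: measurable_posdef_quadrics.
rewrite [X in measurable X](_ : _ = \bigcup_(s in [set s | s \in F])
    \bigcap_(ij in [set: 'I_M * 'I_M])
      ([set p | (class_signs M p ij).1 = (s ij).1] `&`
       [set p | (class_signs M p ij).2 = (s ij).2])).
  apply: fin_bigcup_measurable => [|s _]; first exact: finite_finset.
  apply: fin_bigcap_measurable => [|ij _]; first exact: finite_finset.
  apply: measurableI.
    apply: (mset _ [set A | 0 < qform A (ratvec_nth R n.+1 ij.1) *
                                qform A (ratvec_nth R n.+1 ij.2)]).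
      by have /continuousP/(_ _ (@open_gt R 0)) := prodc (ratvec_nth R n.+1 ij.1)
        (ratvec_nth R n.+1 ij.2).
    by move=> p A pA; rewrite (class_signsE _ pA) ffunE.
  apply: (mset _ [set A | qform A (ratvec_nth R n.+1 ij.1) *
                          qform A (ratvec_nth R n.+1 ij.2) < 0]).
    by have /continuousP/(_ _ (@open_lt R 0)) := prodc (ratvec_nth R n.+1 ij.1)
      (ratvec_nth R n.+1 ij.2).
  by move=> p A pA; rewrite (class_signsE _ pA) ffunE.
apply/seteqP; split => p /= => [pF|[s sF sp]].
  by exists (class_signs M p).
rewrite (_ : class_signs M p = s)//; apply/ffunP => ij.
have [/= h1 h2] := sp ij I.
by rewrite [LHS]surjective_pairing h1 h2 -surjective_pairing.
Qed.

End projective_classes.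

(** * Pencils that contain a definite form, and cliques *)

Section pencils.
Variables (R : realType) (n : nat).
Implicit Types (p : projQuad R n) (A B C : 'M[R]_n.+1).

Lemma posdefD A B : posdef A -> posdef B -> posdef (A + B).
Proof.
move=> pA pB x x0; rewrite -[ltRHS]/(qform _ x) qformD.
by rewrite addr_gt0//; [exact: pA|exact: pB].
Qed.

Lemma posdef_neq0 A : posdef A -> A != 0.
Proof.
move=> pA; apply/eqP => A0.
have x0 : const_mx 1 != 0 :> 'cV[R]_n.+1.
  by apply/eqP => /colP/(_ ord0); rewrite !mxE => /eqP; rewrite oner_eq0.
by have := pA _ x0; rewrite -[ltRHS]/(qform _ _) A0 qform0 ltxx.
Qed.

(** For [C = (A - B) / 2] both forms equal [(A + B) / 2], and openness allows a rational [C] nearby.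
    A joint condition thus becomes a countable union of separate conditions on [A] and [B], which
    makes [pencil_posdef] measurable. *)
Lemma posdefD_split A B : posdef (A + B) <-> exists C : 'M[rat]_n.+1,
  posdef (A + - map_mx ratr C) /\ posdef (B + map_mx ratr C).
Proof.
split=> [pAB|[C [p1 p2]]]; last first.
  by have := posdefD p1 p2; rewrite addrACA addNr addr0.
have pS : posdef (2^-1 *: (A + B)).
  move=> x x0; rewrite -[ltRHS]/(qform _ x) qformZ mulr_gt0 ?invr_gt0//.
  exact: pAB.
have [e e0 eP] := posdef_near pS.
have /choice[f fP] (ij : 'I_n.+1 * 'I_n.+1) : exists q : rat,
    `|(A ij.1 ij.2 - B ij.1 ij.2) / 2 - ratr q| < e.
  set x := (_ / 2); have [|q] := @rat_in_itvoo R x (x + e); first by rewrite ltrDl.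
  rewrite in_itv/= => /andP[q1 q2]; exists q.
  by rewrite ltr_norml; apply/andP; split; lra.
exists (\matrix_(i, j) f (i, j)); split; apply: eP => i j.
  by have := fP (i, j); rewrite /= !mxE distrC; congr (`|_| < _); lra.
by have := fP (i, j); rewrite /= !mxE; congr (`|_| < _); lra.
Qed.

(** The coefficients of the combination are absorbed in the choice of [A] and [B]. *)
Definition pencil_posdef p p' : Prop :=
  exists A B, [/\ rep p A, rep p' B & posdef (A + B)].

Lemma proj_line_meets p p' : ~ posdef_quadrics p -> ~ posdef_quadrics p' ->
  proj_line p p' `&` @posdef_quadrics R n <> set0 <-> pencil_posdef p p'.
Proof.
move=> np np'; split.
  move=> /eqP/set0P[r [[A [B [pA pB [a [b rAB]]]]] [C rC pdC]]].
  have [c c0 CE] := rep_prop rAB rC.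
  have CE' : C = (c * a) *: A + (c * b) *: B by rewrite CE scalerDr !scalerA.
  have C0 := posdef_neq0 pdC.
  (* If a coefficient vanished, [C] would represent [p] or [p'], which lie outside the positive
     definite quadrics. *)
  have [ca|ca] := eqVneq (c * a) 0.
    exfalso; apply: np'; exists C => //; rewrite CE' ca scale0r add0r.
    apply: rep_scale => //; apply: contraNneq C0 => cb.
    by rewrite CE' ca cb !scale0r addr0.
  have [cb|cb] := eqVneq (c * b) 0.
    exfalso; apply: np; exists C => //; rewrite CE' cb scale0r addr0.
    exact: rep_scale.
  exists ((c * a) *: A), ((c * b) *: B); split; [exact: rep_scale..|].
  by rewrite -CE'.
move=> [A [B [pA pB pdAB]]]; apply/eqP/set0P.
have [As _] := rep_sym pA; have [Bs _] := rep_sym pB.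
have [|r rAB] := rep_of _ (posdef_neq0 pdAB); first by rewrite linearD/= As Bs.
exists r; split; last by exists (A + B).
by exists A, B; split => //; exists 1, 1; rewrite !scale1r.
Qed.

Lemma measurable_pencil_posdef d (T : measurableType d)
    (X Y : T -> borelQuad R n) :
  measurable_fun setT X -> measurable_fun setT Y ->
  measurable [set w | pencil_posdef (X w) (Y w)].
Proof.
move=> mX mY; pose C k : 'M[R]_n.+1 := map_mx ratr (odflt (0 : 'M[rat]_n.+1) (unpickle k)).
rewrite (_ : [set w | _] = \bigcup_k
    ((X @^-1` [set p | exists2 A, rep p A & posdef (A + - C k)]) `&`
     (Y @^-1` [set p | exists2 B, rep p B & posdef (B + C k)]))).
  apply: bigcupT_measurable => k; apply: measurableI; rewrite -[X in measurable X]setTI.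
    by apply: mX => //; apply: measurable_rep; exact: open_posdef_add.
  by apply: mY => //; apply: measurable_rep; exact: open_posdef_add.
apply/seteqP; split => w /=.
  move=> [A [B [pA pB /posdefD_split[D [D1 D2]]]]]; exists (pickle D) => //.
  by split; [exists A|exists B]; rewrite // /C pickleK.
move=> [k _ [[A pA A1] [B pB B1]]]; exists A, B; split => //.
by apply/posdefD_split; exists (odflt 0 (unpickle k)).
Qed.

Lemma is_clique_quadricsP (s : nat) (p : 'I_s -> projQuad R n) (S : {set 'I_s}) :
  is_clique (complement_graph (quadrics_graph p)) S <->
  (forall i, i \in S -> ~ posdef_quadrics (p i)) /\
  (forall i j, i \in S -> j \in S -> i <> j -> pencil_posdef (p i) (p j)).
Proof.
split=> [[vS aS]|[vS aS]].
  have nS i : i \in S -> ~ posdef_quadrics (p i) by move=> /vS[].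
  split=> // i j iS jS ij; apply/proj_line_meets; [exact: nS..|].
  have [_ _ _ nadj] := aS _ _ iS jS ij; move=> l0; apply: nadj; split; [exact: nS..|].
  by split.
split=> [i iS|i j iS jS ij]; first by split; [|exact: vS].
split => //; [by split; [|exact: vS]..|].
move=> [_ _ [_ l0]].
by have := (proj_line_meets (vS _ iS) (vS _ jS)).2 (aS _ _ iS jS ij).
Qed.

(** One product would be both positive and negative. This covers distinct points of a clique with
    the same pattern. *)
Lemma signs_cross_irrefl M A : ~~ signs_cross (signs M A) (signs M A).
Proof.
apply/negP => /existsP[[[i1 i2] [i3 i4]]] /and5P[+ _ _ +].
by rewrite /= !ffunE /= => h1 h2; have := lt_trans h1 h2; rewrite ltxx.
Qed.

Lemma pencil_posdef_not_cross M p p' : pencil_posdef p p' ->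
  ~~ signs_cross (class_signs M p) (class_signs M p').
Proof.
move=> [A [B [pA pB pd]]]; rewrite (class_signsE _ pA) (class_signsE _ pB).
rewrite signs_crossE; apply: (@posdef_pencil_not_crosses _ _ _ _ _ 1 1).
by rewrite !scale1r.
Qed.

(** [F] collects the patterns of the points of the clique; it ranges over a finite type that depends
    on [M] but not on [s]. *)
Lemma clique_sign_cell M (s : nat) (p : 'I_s -> projQuad R n) (S : {set 'I_s}) :
  is_clique (complement_graph (quadrics_graph p)) S ->
  exists F : {set {ffun 'I_M * 'I_M -> bool * bool}},
    (forall x y, x \in F -> y \in F -> ~~ signs_cross x y) /\
    forall i, i \in S -> @sign_cell R n M F (p i).
Proof.
move=> /is_clique_quadricsP[nS cS].
exists [set class_signs M (p i) | i in S]%SET; split.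
  move=> _ _ /imsetP[i iS ->] /imsetP[j jS ->]; have [->|/eqP ij] := eqVneq i j.
    exact: signs_cross_irrefl.
  exact/pencil_posdef_not_cross/cS.
by move=> i iS; split; [exact: nS|exact: imset_f].
Qed.

End pencils.

(** * The uniform measure of a union of sign cells *)

Section uniform.
Variables (R : realType) (n : nat).
Local Notation mtupN := ((quadN n).+1.-tuple (measurableTypeR R)).
Local Notation sym t := (@sym_of_tuple R n t).

Lemma measurable_signs_in M (F : {set {ffun 'I_M * 'I_M -> bool * bool}}) :
  measurable ([set t | signs M (sym t) \in F] : set mtupN).
Proof.
pose f (ij : 'I_M * 'I_M) (t : mtupN) : R :=
  qform (sym t) (ratvec_nth R n.+1 ij.1) * qform (sym t) (ratvec_nth R n.+1 ij.2).
have mf ij : measurable_fun setT (f ij).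
  by apply: measurable_funM; exact: measurable_qform_sym.
rewrite (_ : [set t | _] = \bigcup_(s in [set s | s \in F])
    \bigcap_(ij in [set: 'I_M * 'I_M])
      ((fun t => 0 < f ij t) @^-1` [set (s ij).1] `&`
       (fun t => f ij t < 0) @^-1` [set (s ij).2])).
  apply: fin_bigcup_measurable => [|s _]; first exact: finite_finset.
  apply: fin_bigcap_measurable => [|ij _]; first exact: finite_finset.
  apply: measurableI; rewrite -[X in measurable X]setTI.
    have mc := measurable_fun_ltr (@measurable_cst _ _ _ R setT 0) (mf ij).
    exact: (mc measurableT [set (s ij).1] I).
  have mc := measurable_fun_ltr (mf ij) (@measurable_cst _ _ _ R setT 0).
  exact: (mc measurableT [set (s ij).2] I).
apply/seteqP; split => t /= => [tF|[s sF st]].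
  by exists (signs M (sym t)) => // ij _; rewrite /= ffunE.
rewrite (_ : signs M (sym t) = s)//; apply/ffunP => ij.
by have [/= h1 h2] := st ij I; rewrite ffunE [RHS]surjective_pairing -h1 -h2.
Qed.

(** The cone over the cell is a set of pairwise non-crossing nondefinite forms in the unit ball, so
    [noncrossing_small] applies, with [e V] to offset the division by the total volume [V]. *)
Lemma sign_cell_small (e : R) : uniform_quad [set: projQuad R n] = 1%E -> 0 < e ->
  exists M, forall F : {set {ffun 'I_M * 'I_M -> bool * bool}},
    (forall x y, x \in F -> y \in F -> ~~ signs_cross x y) ->
    (uniform_quad (@sign_cell R n M F) <= e%:E)%E.
Proof.
rewrite /uniform_quad; set V := fine (cone_volume setT) => VV e0.
have [m [mE mfin mtr]] := lebesgue_tuple_measure R (quadN n).+1.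
have mnz : measurable ([set t | sym t != 0] : set mtupN).
  rewrite (_ : [set t | _] = ~` \bigcap_(ij in [set: 'I_n.+1 * 'I_n.+1])
      [set t | sym t ij.1 ij.2 = 0]).
    apply: measurableC; apply: fin_bigcap_measurable => [|ij _]; first exact: finite_finset.
    rewrite -[X in measurable X]setTI.
    by apply: (@measurable_sym_entry R n ij.1 ij.2 _ [set 0]) => //; exact: measurable_set1.
  apply/seteqP; split => t /=.
    move=> t0 h; move/eqP: t0; apply; apply/matrixP => i j; rewrite [RHS]mxE.
    exact: (h (i, j) I).
  by apply: contra_not_neq => /matrixP t0 ij _ /=; rewrite t0 mxE.
have coneE (B : set (projQuad R n)) : cone_volume B = @lebesgue_tuple R _
    [set t | frobenius (sym t) (sym t) <= 1 /\ exists2 p, B p & rep p (sym t)].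
  by [].
have V0 : 0 < V.
  have VE : V = fine (m [set t | frobenius (sym t) (sym t) <= 1 /\ sym t != 0]).
    rewrite mE; last first.
      by apply: measurableI => //; exact: measurable_frobenius_le1.
    congr (fine (lebesgue_tuple _)); apply/seteqP; split => t /= [-> h]; split => //.
      by have [p _ pt] := h; have [] := rep_sym pt.
    by have [p pt] := rep_of (sym_of_tuple_sym t) h; exists p.
  (* If [V] were 0, the normalised total volume would be [0 / 0 = 0] instead of 1. *)
  rewrite lt_neqAle {2}VE fine_ge0// andbT eq_sym; apply/eqP => V00; move: VV.
  by rewrite V00 mul0r => -[] /eqP; rewrite eq_sym oner_eq0.
have [M MP] := noncrossing_small mfin mtr (mulr_gt0 e0 V0).
exists M => F FP; rewrite lee_fin ler_pdivrMr//.
(* The cone is rewritten without the existential over classes, which makes its measurability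
   visible. *)
pose U : set mtupN := [set t | frobenius (sym t) (sym t) <= 1 /\
  (sym t != 0 /\ (nondefinite (sym t) /\ signs M (sym t) \in F))].
have mU : measurable U.
  apply: measurableI; first exact: measurable_frobenius_le1.
  apply: measurableI => //; apply: measurableI; first exact: measurable_nondefinite.
  exact: measurable_signs_in.
rewrite coneE (_ : [set t | _] = U).
  have mUe : (m U <= (e * V)%:E)%E.
    apply: MP => //; first by move=> t [? [_ []]].
    by move=> t t' [_ [_ [_ tF]]] [_ [_ [_ tF']]]; rewrite -signs_crossE; exact: FP.
  rewrite -mE// -lee_fin fineK// ge0_fin_numE//.
  exact: le_lt_trans mUe (ltry _).
apply/seteqP; split => t /= [f1 h]; split => //.
  have [p [np pF] pt] := h; have [_ t0] := rep_sym pt; split => //.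
  by split; [exact: posdef_quadricsN pt np|rewrite -(class_signsE _ pt)].
have [t0 [nt tF]] := h; have [p pt] := rep_of (sym_of_tuple_sym t) t0.
exists p => //; split; first exact: nondefinite_class pt nt.
by rewrite (class_signsE _ pt).
Qed.

End uniform.

(** * Random cliques *)

Lemma measure_le_fin_cover d (T : measurableType d) (R : realType)
    (m : {measure set T -> \bar R}) (I : finType) (A : set T) (D : I -> set T) (y : R) :
  measurable A -> (forall i, measurable (D i)) -> A `<=` \bigcup_i D i ->
  (forall i, (m (D i) <= y%:E)%E) -> (m A <= (y *+ #|I|)%:E)%E.
Proof.
move=> mA mD AD Dy.
pose Z r : set T := if insub r is Some k then D (@enum_val I predT k) else set0.
rewrite -[y *+ _]add0r.
apply: (@measure_le_cover _ T R m A set0 #|I| Z) => //.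
- by move=> r; rewrite /Z; case: insub.
- move=> t /AD[i _ Dt]; right; rewrite -bigcup_mkord; exists (enum_rank i) => /=.
    exact: ltn_ord.
  by rewrite /Z valK enum_rankK.
- by rewrite measure0.
- by move=> r rI; rewrite /Z insubT.
Qed.

Lemma prode_le_const (R : realType) (I : finType) (S : {set I}) (f : I -> \bar R)
    (y : R) :
  (forall i, i \in S -> 0 <= f i)%E -> (forall i, i \in S -> f i <= y%:E)%E ->
  (\prod_(i in S) f i <= (y ^+ #|S|)%:E)%E.
Proof.
move=> f0 fy; rewrite -prodr_const.
suff /andP[] : ((0 <= \prod_(i in S) f i) && (\prod_(i in S) f i <= (\prod_(i in S) y)%:E))%E.
  by [].
elim/big_rec2: _ => [|i x z iS /andP[z0 zx]]; first by rewrite lee01/=.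
by rewrite mule_ge0 ?f0//= EFinM lee_pmul ?f0 ?fy.
Qed.

Section random_cliques.
Variables (R : realType) (n : nat).
Variables (d : measure_display) (T : measurableType d) (P : probability T R).
Variables (s : nat) (q : 'I_s -> {RV P >-> borelQuad R n}).

Definition clique_event (S : {set 'I_s}) : set T :=
  [set w | is_clique (complement_graph (quadrics_graph (fun i => q i w))) S].

Lemma measurable_clique_event S : measurable (clique_event S).
Proof.
rewrite (_ : clique_event S =
    (\bigcap_(i in [set i | i \in S]) (q i @^-1` (~` @posdef_quadrics R n))) `&`
    \bigcap_(ij in [set ij : 'I_s * 'I_s | [/\ ij.1 \in S, ij.2 \in S & ij.1 <> ij.2]])
      [set w | pencil_posdef (q ij.1 w) (q ij.2 w)]).
  apply: measurableI.
    apply: fin_bigcap_measurable => [|i _]; first exact: finite_finset.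
    rewrite -[X in measurable X]setTI; apply: (measurable_funPT (q i)) => //.
    by apply: measurableC; exact: (@measurable_posdef_quadrics R n).
  apply: fin_bigcap_measurable => [|ij _]; first exact: finite_finset.
  apply: measurable_pencil_posdef; first exact: (measurable_funPT (q ij.1)).
  exact: (measurable_funPT (q ij.2)).
apply/seteqP; split => w /=.
  move=> /is_clique_quadricsP[h1 h2]; split => [i iS|[i j] [iS jS ij]]; first exact: h1.
  exact: h2.
move=> [h1 h2]; apply/is_clique_quadricsP; split => [i iS|i j iS jS ij]; first exact: h1.
exact: (h2 (i, j)).
Qed.

(** This is a union bound over the pairs of a pattern set [F] and an index set [S]; by independence
    the points indexed by [S] all fall in the cell of [F] with probability at most
    [(e ^+ k) ^+ #|S|]. *)
Lemma large_clique_bound (M : nat) (e eps : R) (k : nat) :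
  iid_uniform q -> 0 <= e <= 1 ->
  (forall F : {set {ffun 'I_M * 'I_M -> bool * bool}},
    (forall x y, x \in F -> y \in F -> ~~ signs_cross x y) ->
    (uniform_quad (@sign_cell R n M F) <= (e ^+ k)%:E)%E) ->
  1 <= k%:R * eps ->
  (P [set w | exists S : {set 'I_s},
     is_clique (complement_graph (quadrics_graph (fun i => q i w))) S /\
     (eps * s%:R <= #|S|%:R)%R] <=
   ((e ^+ s) *+ (#|{set {ffun 'I_M * 'I_M -> bool * bool}}| * 2 ^ s))%:E)%E.
Proof.
move=> [ind unif] /andP[e0 e1] small keps.
pose good (F : {set {ffun 'I_M * 'I_M -> bool * bool}}) :=
  [forall x, forall y, (x \in F) ==> ((y \in F) ==> ~~ signs_cross x y)].
(* Pairs that no large clique produces get the empty event, so one bound serves all pairs. *)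
pose D (FS : {set {ffun 'I_M * 'I_M -> bool * bool}} * {set 'I_s}) : set T :=
  if good FS.1 && (eps * s%:R <= #|FS.2|%:R)
  then \bigcap_(i in [set` FS.2]) (q i @^-1` (@sign_cell R n M FS.1)) else set0.
have mcell F i : measurable (q i @^-1` (@sign_cell R n M F)).
  rewrite -[X in measurable X]setTI; apply: (measurable_funPT (q i)) => //.
  exact: measurable_sign_cell.
have -> : (#|{set {ffun 'I_M * 'I_M -> bool * bool}}| * 2 ^ s)%N =
    #|{: {set {ffun 'I_M * 'I_M -> bool * bool}} * {set 'I_s}}|.
  have := card_powerset [set: 'I_s]%SET; rewrite powersetT !cardsT card_ord => <-.
  by rewrite card_prod.
apply: (measure_le_fin_cover (D := D)).
- rewrite (_ : [set w | _] =
      \bigcup_(S in [set S : {set 'I_s} | eps * s%:R <= #|S|%:R]) clique_event S).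
    apply: fin_bigcup_measurable => [|S _]; first exact: finite_finset.
    exact: measurable_clique_event.
  by apply/seteqP; split => w /= [S]; [move=> [h1 h2]|move=> h2 h1]; exists S.
- move=> [F S]; rewrite /D; case: ifP => // _.
  by apply: fin_bigcap_measurable => [|i _]; [exact: finite_finset|exact: mcell].
- move=> w [S [cS szS]]; have [F [gF FS]] := clique_sign_cell M cS.
  exists (F, S) => //; rewrite /D /= szS andbT ifT//.
  apply/forallP => x; apply/forallP => y; apply/implyP => xF; apply/implyP => yF.
  exact: gF.
- move=> [F S]; rewrite /D /=; case: ifP => [/andP[gF szS]|_]; last first.
    by rewrite measure0 lee_fin exprn_ge0.
  rewrite (ind S (fun=> @sign_cell R n M F)); last first.
    by move=> i _; exact: measurable_sign_cell.
  apply: (@le_trans _ _ ((e ^+ k) ^+ #|S|)%:E).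
    apply: prode_le_const => i iS //.
    have := unif i _ (@measurable_sign_cell R n M F); rewrite /distribution /pushforward => ->.
    apply: small => x y xF yF.
    by move/forallP: gF => /(_ x)/forallP/(_ y)/implyP/(_ xF)/implyP/(_ yF).
  (* As [e <= 1], it suffices that [s <= k #|S|], which follows from [k eps >= 1] and
     [#|S| >= eps s]. *)
  rewrite lee_fin -exprM ler_wiXn2l//.
  rewrite -(@ler_nat R) natrM.
  have : k%:R * (eps * s%:R) <= k%:R * #|S|%:R by rewrite ler_wpM2l.
  apply: le_trans; rewrite mulrA ler_peMl//.
Qed.

End random_cliques.

Unset Implicit Arguments.
Set Strict Implicit.

Theorem corollary17 (R : realType) (n : nat) (hn : (2 <= n)%N)
  (d : nat -> measure_display) (T : forall s, measurableType (d s))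
  (P : forall s, probability (T s) R)
  (q : forall s, 'I_s -> {RV (P s) >-> borelQuad R n})
  (hq : forall s, iid_uniform (q s))
  (eps : R) (heps : 0 < eps) :
  P s [set w : T s | exists S : {set 'I_s},
         is_clique (complement_graph (quadrics_graph (fun i => q s i w))) S /\
         eps * s%:R <= #|S|%:R] @[s --> \oo] --> 0%E.
Proof.
(* The normalisation is read off from the law of a sample point; [s = 1] ensures that there is
   one. *)
have unif1 : uniform_quad [set: projQuad R n] = 1%E.
  have [_ /(_ ord0 setT measurableT) <-] := hq 1%N.
  exact: probability_setT.
pose k := Num.bound eps^-1.
have keps : 1 <= k%:R * eps.
  rewrite -ler_pdivrMr// mul1r; apply/ltW/archi_boundP.
  by rewrite invr_ge0 ltW.
(* Against the [2 ^ s] index sets, [4^-1] leaves a factor [2^-1 ^+ s], which tends to 0. *)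
have e0 : 0 < 4^-1 :> R by rewrite invr_gt0.
have [M MP] := sign_cell_small unif1 (exprn_gt0 k e0).
have e01 : (0 <= 4^-1 :> R) && (4^-1 <= 1 :> R).
  by rewrite ltW//=; lra.
have bound s := large_clique_bound (hq s) e01 MP keps.
set c := #|_| in bound.
apply: (@squeeze_cvge _ _ _ _ (cst 0%E) _ (fun s => (c%:R * 2^-1 ^+ s)%:E)).
- apply: nearW => s; rewrite measure_ge0/=; apply: le_trans (bound s) _.
  rewrite lee_fin -mulr_natl natrM natrX -mulrA -exprMn.
  by rewrite (_ : 2 * 4^-1 = 2^-1 :> R)//; lra.
- exact: cvg_cst.
- apply/cvg_EFin; first exact: nearW.
  rewrite -[X in _ --> X](mulr0 c%:R); apply: cvgMl_tmp; apply: cvg_expr.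
  by rewrite ger0_norm; lra.
Qed.
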